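(* An optimal solution of (Static-URFL) can be rounded to give a $4$-approximation to (URFL). That is, there is a polynomial-time algorithm that, given any (rational) instance $(\mathcal F,\mathcal C,d,c,k)$ and an optimal solution of (Static-URFL) for it, outputs a feasible (integral) solution of (URFL), given by its first-stage vector $x\in\{0,1\}^{\mathcal F}$ with each client of a realized scenario assigned to a closest open facility, whose cost in (URFL) is at most $4$ times the optimal value of (URFL).
   Context: An instance consists of a nonempty finite set $\mathcal F$ of $n$ facilities and a finite set $\mathcal C$ of $m$ clients in a common metric space with distance $d$ ($d_{ij}$ is the distance between $i$ and $j$), a cost $c_i\ge 0$ for each $i\in\mathcal F$ (the cost of opening facility $i$ with unlimited supply), and an integer $k\ge 1$. The set of scenarios $\mathcal C^k$ is the family of all subsets of $\mathcal C$ of size at most $k$. The uncapacitated robust facility location problem (URFL) is $$\min\ \sum_{i\in\mathcal F}c_ix_i+\max_{S\in\mathcal C^k}\sum_{i\in\mathcal F}\sum_{j\in S}d_{ij}y^S_{ij}$$ subject to $\sum_{i\in\mathcal F}y^S_{ij}\ge 1$ for all $S\in\mathcal C^k$, $j\in S$; $x_i\ge y^S_{ij}$ for all $i\in\mathcal F$, $S\in\mathcal C^k$, $j\in S$; $x_i\in\{0,1\}$ and $y^S_{ij}\ge 0$ for all $i\in\mathcal F$, $S\in\mathcal C^k$, $j\in S$. The problem (Static-URFL) is obtained from (URFL) by relaxing $x_i\in\{0,1\}$ to $x_i\ge 0$ and restricting the second-stage variables to be independent of the scenario ($y^S_{ij}=y_{ij}$): $$\min\ \sum_{i\in\mathcal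 F}c_ix_i+\max_{S\in\mathcal C^k}\sum_{i\in\mathcal F}\sum_{j\in S}d_{ij}y_{ij}$$ subject to $\sum_{i\in\mathcal F}y_{ij}\ge 1$ for all $j\in\mathcal C$; $x_i\ge y_{ij}\ge 0$ for all $i\in\mathcal F$, $j\in\mathcal C$. Polynomial time means polynomial in the encoding length of the input. *)

(* Defs.v *)
From HB Require Import structures.
From mathcomp Require Import all_boot all_order all_algebra.
From mathcomp Require Import reals metric_structure.

Set Implicit Arguments.
Unset Strict Implicit.
Unset Printing Implicit Defensive.

Import Order.TTheory GRing.Theory Num.Theory.
Local Open Scope ring_scope.

Section Programs.
Context (R : realType) (F C : finType).
Variables (c : F -> R) (d : F -> C -> R) (k : nat).
Implicit Types (x : F -> R) (y : F -> C -> R) (z : {set C} -> F -> C -> R).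

Definition scenarios : {set {set C}} := [set S : {set C} | (#|S| <= k)%N].

(* In both costs below the default value 0 of the maximum is attained by the
   scenario S = set0, so the big operator is the maximum over all scenarios.
   A value z S i j with j \notin S is never used. *)
Definition urfl_cost x z : R :=
  \sum_i c i * x i
  + \big[Num.max/0]_(S in scenarios) \sum_i \sum_(j in S) d i j * z S i j.

Definition urfl_feasible x z : Prop :=
  [/\ forall S j, S \in scenarios -> j \in S -> 1 <= \sum_i z S i j,
      forall i S j, S \in scenarios -> j \in S -> z S i j <= x i,
      forall i, x i = 0 \/ x i = 1
    & forall i S j, S \in scenarios -> j \in S -> 0 <= z S i j].

Definition urfl_optimal_value (v : R) : Prop :=
  (exists x z, urfl_feasible x z /\ urfl_cost x z = v) /\
  (forall x z, urfl_feasible x z -> v <= urfl_cost x z).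

Definition static_cost x y : R :=
  \sum_i c i * x i
  + \big[Num.max/0]_(S in scenarios) \sum_i \sum_(j in S) d i j * y i j.

Definition static_feasible x y : Prop :=
  [/\ forall j, 1 <= \sum_i y i j,
      forall i, 0 <= x i
    & forall i j, 0 <= y i j <= x i].

Definition static_optimal x y : Prop :=
  static_feasible x y /\
  (forall x' y', static_feasible x' y' -> static_cost x y <= static_cost x' y').

Definition closest_open x (i : F) (j : C) : Prop :=
  x i = 1 /\ forall i', x i' = 1 -> d i j <= d i' j.

Definition closest_assignment x z : Prop :=
  forall S j, S \in scenarios -> j \in S ->
  exists i, closest_open x i j /\ forall i', z S i' j = (i' == i)%:R.

End Programs.

Record instance := Instance {
  nF : nat;
  nC : nat;
  bound : nat;
  ocost : 'I_nF -> rat;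
  dst : 'I_nF -> 'I_nC -> rat
}.

(* Facilities and clients are points of a real metric space; distinct
   facilities or clients may share a location. *)
Definition valid_instance (R : realType) (I : instance) : Prop :=
  [/\ (0 < nF I)%N, (0 < bound I)%N, forall i, 0 <= @ocost I i
    & exists (X : metricType R) (locF : 'I_(nF I) -> X) (locC : 'I_(nC I) -> X),
        forall i j, ratr (@dst I i j) = mdist (locF i) (locC j)].

Definition rcost (R : realType) (I : instance) : 'I_(nF I) -> R :=
  fun i => ratr (@ocost I i).
Definition rdst (R : realType) (I : instance) : 'I_(nF I) -> 'I_(nC I) -> R :=
  fun i j => ratr (@dst I i j).

(* Model of computation: a random access machine over the integers with
   +, -, * and indirect addressing, under the logarithmic cost criterion.
   Control flow is given by structured commands.  Every integer occurring during
   the evaluation of an expression (constants, addresses, fetched values,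
   results) is charged its bit length.  A product of two integers of bit lengths
   a and b has bit length at most a + b and is computed by a Turing machine in
   time polynomial in a + b, so running time polynomial in this measure
   coincides with polynomial time on Turing machines. *)

Definition bitlen (z : int) : nat := (trunc_log 2 `|z|%N).+1.

Definition memory := int -> int.

Inductive expr : Type :=
  | Const of int
  | Fetch of expr
  | Plus of expr & expr
  | Minus of expr & expr
  | Times of expr & expr.

Fixpoint eval (s : memory) (e : expr) : int :=
  match e with
  | Const z => z
  | Fetch a => s (eval s a)
  | Plus e1 e2 => eval s e1 + eval s e2
  | Minus e1 e2 => eval s e1 - eval s e2
  | Times e1 e2 => eval s e1 * eval s e2
  end.

Fixpoint eval_cost (s : memory) (e : expr) : nat :=
  (bitlen (eval s e) +
   match e with
   | Const _ => 0
   | Fetch a => eval_cost s a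
   | Plus e1 e2 | Minus e1 e2 | Times e1 e2 => eval_cost s e1 + eval_cost s e2
   end)%N.

Definition update (s : memory) (a v : int) : memory :=
  fun b => if b == a then v else s b.

(* [Store a e] writes the value of e at the address given by the value of a;
   the tests of [If] and [While] succeed on positive values. *)
Inductive cmd : Type :=
  | Skip
  | Store of expr & expr
  | Seq of cmd & cmd
  | If of expr & cmd & cmd
  | While of expr & cmd.

(* [exec p s s' t]: started in memory s, p halts in memory s' after time t. *)
Inductive exec : cmd -> memory -> memory -> nat -> Prop :=
  | ExecSkip s : exec Skip s s 1
  | ExecStore a e s :
      exec (Store a e) s (update s (eval s a) (eval s e))
           (eval_cost s a + eval_cost s e)
  | ExecSeq p q s s' s'' t t' :
      exec p s s' t -> exec q s' s'' t' -> exec (Seq p q) s s'' (t + t')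
  | ExecIfTrue e p q s s' t :
      0 < eval s e -> exec p s s' t -> exec (If e p q) s s' (eval_cost s e + t)
  | ExecIfFalse e p q s s' t :
      eval s e <= 0 -> exec q s s' t -> exec (If e p q) s s' (eval_cost s e + t)
  | ExecWhileTrue e p s s' s'' t t' :
      0 < eval s e -> exec p s s' t -> exec (While e p) s' s'' t' ->
      exec (While e p) s s'' (eval_cost s e + t + t')
  | ExecWhileFalse e p s :
      eval s e <= 0 -> exec (While e p) s s (eval_cost s e).

Lemma exec_deterministic p s s1 s2 t1 t2 :
  exec p s s1 t1 -> exec p s s2 t2 -> s1 = s2 /\ t1 = t2.
Proof.
move=> h; elim: h s2 t2 => {p s s1 t1} [s|a e s|p q s s' s'' t t' _ IHp _ IHq
  |e p q s s' t e0 _ IH|e p q s s' t e0 _ IH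
  |e p s s' s'' t t' e0 _ IHp _ IHq|e p s e0] s2 t2 h; inversion h; subst;
  repeat match goal with
  | H1 : is_true (0 < ?a), H2 : is_true (?a <= 0) |- _ =>
      by move: H1; rewrite ltNge H2
  | IH : forall s t, exec ?p ?s0 s t -> _, H : exec ?p ?s0 _ _ |- _ =>
      case: (IH _ _ H) => ? ?; subst; clear H
  end; by [].
Qed.

Definition code_rat (q : rat) : seq int := [:: numq q; denq q].

(* An instance followed by a pair (x, y); matrices are listed row by row. *)
Definition encode (I : instance)
    (x : 'I_(nF I) -> rat) (y : 'I_(nF I) -> 'I_(nC I) -> rat) : seq int :=
  [:: (nF I)%:Z; (nC I)%:Z; (bound I)%:Z]
  ++ flatten [seq code_rat (@ocost I i) | i <- enum 'I_(nF I)]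
  ++ flatten [seq code_rat (@dst I i j) | i <- enum 'I_(nF I), j <- enum 'I_(nC I)]
  ++ flatten [seq code_rat (x i) | i <- enum 'I_(nF I)]
  ++ flatten [seq code_rat (y i j) | i <- enum 'I_(nF I), j <- enum 'I_(nC I)].

Definition encoding_length (w : seq int) : nat := (\sum_(z <- w) bitlen z)%N.

(* The input occupies the cells 0, 1, 2, ...; all other cells contain 0. *)
Definition input_memory (w : seq int) : memory :=
  fun a => if a is Posz i then w`_i else 0.

(* The output vector is read off the cells 0, ..., n - 1. *)
Definition output_vector (R : realType) (n : nat) (s : memory) : 'I_n -> R :=
  fun i => (s (val i)%:Z)%:~R.

(* Main.v *)
(* For client j let D j be the sum of d i j * y i j over the facilities i, and
   call i near j if d i j <= 4/3 * D j.  By Markov's inequality the facilities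
   near j carry at least a quarter of the demand of j, so the cheapest of them
   costs at most four times the static opening cost of the facilities near j.
   Repeatedly take a client j of least D j whose near facilities are all
   uncovered, open its cheapest near facility and cover all its near facilities.
   The covered sets are disjoint, so the opening cost is at most four times the
   static one.  Every client j' finally shares a near facility with some chosen
   j such that D j <= D j', and reaches the facility opened for j within
   4/3 * (D j' + D j + D j) <= 4 * D j'.  As the detour bound holds for each
   client, it holds in each scenario.  The static optimum is at most the optimum
   of (URFL) because, for integral x, assigning every client to a nearest open
   facility is optimal in all scenarios simultaneously.

   The running time is bounded syntactically: if no loop makes more than N
   iterations per entry and no cell ever exceeds B bits, the time is at most a
   polynomial in N and B determined by the program. *)

Require Import Defs.
From HB Require Import structures.
From mathcomp Require Import all_boot all_order all_algebra.
From mathcomp Require Import reals metric_structure.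
From mathcomp Require Import zify ring lra.

Set Implicit Arguments.
Unset Strict Implicit.
Unset Printing Implicit Defensive.

Import Order.TTheory GRing.Theory Num.Theory.
Local Open Scope ring_scope.

(** * Running time and weakest preconditions *)

(** The conjunct [0 < b] is due to zero, which has bit length 1 although it is below [2 ^ 0]. *)
Lemma bitlen_le z b : (bitlen z <= b)%N = (0 < b)%N && (`|z| < 2 ^ b)%N.
Proof.
rewrite /bitlen; case: b => [|b] //=; rewrite ltnS.
have [-> | z0] := posnP `|z|%N; first by rewrite trunc_log0 expn_gt0.
apply/idP/idP => h.
  by apply: leq_trans (@trunc_log_ltn 2 _ isT) _; apply: leq_pexp2l.
by rewrite -ltnS -(ltn_exp2l _ _ (isT : 1 < 2)%N) (leq_ltn_trans _ h) ?trunc_logP.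
Qed.

Lemma bitlen_gt0 z : (0 < bitlen z)%N.
Proof. by []. Qed.

Lemma ltn_bitlen z : (`|z| < 2 ^ bitlen z)%N.
Proof. by have := bitlen_le z (bitlen z); rewrite leqnn => /esym/andP[]. Qed.

(** Exponentially wasteful, but enough for constants, counters and flags, whose values are at most
    linear in the input length. *)
Lemma bitlen_small z b : (`|z| < b)%N -> (bitlen z <= b)%N.
Proof.
move=> h; rewrite bitlen_le (leq_ltn_trans _ h) //=.
exact: ltn_trans h (ltn_expl _ _).
Qed.

Lemma bitlenD a b : (bitlen (a + b) <= bitlen a + bitlen b)%N.
Proof.
rewrite bitlen_le addn_gt0 bitlen_gt0 /= expnD.
have [] := (ltn_bitlen a, ltn_bitlen b).
have := leq_pexp2l (isT : 0 < 2)%N (bitlen_gt0 a).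
have := leq_pexp2l (isT : 0 < 2)%N (bitlen_gt0 b).
rewrite !expn1; nia.
Qed.

Lemma bitlenN a : bitlen (- a) = bitlen a.
Proof. by rewrite /bitlen abszN. Qed.

Lemma bitlenM a b : (bitlen (a * b) <= bitlen a + bitlen b)%N.
Proof.
rewrite bitlen_le addn_gt0 bitlen_gt0 /= expnD abszM.
by rewrite ltn_mul ?ltn_bitlen.
Qed.

(** Products add bit lengths, so for a fixed expression the bound is affine in [B]. *)
Fixpoint value_bound (e : expr) (B : nat) : nat :=
  match e with
  | Const z => bitlen z
  | Fetch _ => B
  | Plus e1 e2 | Minus e1 e2 | Times e1 e2 => value_bound e1 B + value_bound e2 B
  end.

Fixpoint expr_time (e : expr) (B : nat) : nat :=
  (value_bound e B +
   match e with
   | Const _ => 0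
   | Fetch a => expr_time a B
   | Plus e1 e2 | Minus e1 e2 | Times e1 e2 => expr_time e1 B + expr_time e2 B
   end)%N.

(* A bound for the running time when every cell holds at most B bits throughout
   and every entry into a loop leads to at most N iterations. *)
Fixpoint cmd_time (p : cmd) (N B : nat) : nat :=
  match p with
  | Skip => 1
  | Store a e => expr_time a B + expr_time e B
  | Seq p q => cmd_time p N B + cmd_time q N B
  | If e p q => expr_time e B + (cmd_time p N B + cmd_time q N B)
  | While e p => N.+1 * (expr_time e B + cmd_time p N B)
  end%N.

Definition memory_bounded (B : nat) (s : memory) : Prop :=
  forall a, (bitlen (s a) <= B)%N.

Lemma bitlen_eval B s e :
  memory_bounded B s -> (bitlen (eval s e) <= value_bound e B)%N.
Proof.
move=> sB; elim: e => //= [e1 IH1 e2 IH2|e1 IH1 e2 IH2|e1 IH1 e2 IH2].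
- by rewrite (leq_trans (bitlenD _ _)) ?leq_add.
- by rewrite (leq_trans (bitlenD _ _)) ?bitlenN ?leq_add.
- by rewrite (leq_trans (bitlenM _ _)) ?leq_add.
Qed.

Lemma eval_cost_le B s e :
  memory_bounded B s -> (eval_cost s e <= expr_time e B)%N.
Proof.
move=> sB; elim: e => /= [z|a IH|e1 IH1 e2 IH2|e1 IH1 e2 IH2|e1 IH1 e2 IH2].
- by [].
- by rewrite leq_add ?sB.
- by rewrite !leq_add // (bitlen_eval (Plus e1 e2) sB).
- by rewrite !leq_add // (bitlen_eval (Minus e1 e2) sB).
- by rewrite !leq_add // (bitlen_eval (Times e1 e2) sB).
Qed.

(** Equality with a polynomial, rather than domination by one, makes closure under sums and products
    immediate. *)
Definition poly_bounded (f : nat -> nat) : Prop :=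
  exists p : {poly nat}, forall L, f L = p.[L].

Lemma poly_bounded_cst c : poly_bounded (fun=> c).
Proof. by exists c%:P => L; rewrite hornerC. Qed.

Lemma poly_bounded_id : poly_bounded id.
Proof. by exists 'X => L; rewrite hornerX. Qed.

Lemma poly_boundedD f g :
  poly_bounded f -> poly_bounded g -> poly_bounded (fun L => f L + g L)%N.
Proof. by move=> [p fp] [q gq]; exists (p + q) => L; rewrite hornerD fp gq. Qed.

Lemma poly_boundedM f g :
  poly_bounded f -> poly_bounded g -> poly_bounded (fun L => f L * g L)%N.
Proof. by move=> [p fp] [q gq]; exists (p * q) => L; rewrite hornerM fp gq. Qed.

Lemma poly_bounded_expr_time e B :
  poly_bounded B -> poly_bounded (fun L => expr_time e (B L)).
Proof.
move=> PB.
have PV e' : poly_bounded (fun L => value_bound e' (B L)).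
  by elim: e' => //= *; do ?[exact: poly_bounded_cst | exact: poly_boundedD].
by elim: e => /= *; do ?[exact: poly_bounded_cst | apply: poly_boundedD => //];
  exact: PV.
Qed.

Lemma poly_bounded_cmd_time p N B :
  poly_bounded N -> poly_bounded B -> poly_bounded (fun L => cmd_time p (N L) (B L)).
Proof.
move=> PN PB; have PE e := poly_bounded_expr_time e PB.
elim: p => [|a e|p IHp q IHq|e p IHp q IHq|e p IHp].
- exact: poly_bounded_cst 1.
- exact (poly_boundedD (PE a) (PE e)).
- exact (poly_boundedD IHp IHq).
- exact (poly_boundedD (PE e) (poly_boundedD IHp IHq)).
exact (poly_boundedM (poly_boundedD (poly_bounded_cst 1) PN)
                     (poly_boundedD (PE e) IHp)).
Qed.

Section WeakestPrecondition.
Variables N B : nat.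
Implicit Types (Q : memory -> Prop) (s : memory).

(** Total correctness with a time bound. Boundedness of the memory is passed from command to command
    inside the predicate, so only stores have to show that a value fits. *)
Definition wp (p : cmd) Q s : Prop :=
  memory_bounded B s -> exists s' t,
  [/\ exec p s s' t, (t <= cmd_time p N B)%N, memory_bounded B s' & Q s'].

Lemma wp_mono p Q Q' s : (forall s', Q s' -> Q' s') -> wp p Q s -> wp p Q' s.
Proof.
move=> QQ' h /h[s' [t [? ? ? /QQ' ?]]]; by exists s', t.
Qed.

Lemma wp_skip Q s : Q s -> wp Skip Q s.
Proof. by move=> Qs sB; exists s, 1%N; split=> //; constructor. Qed.

Lemma wp_store a e Q s : (bitlen (eval s e) <= B)%N ->
  Q (update s (eval s a) (eval s e)) -> wp (Store a e) Q s.
Proof.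
move=> eB Qs sB; exists (update s (eval s a) (eval s e)),
  (eval_cost s a + eval_cost s e)%N; split=> //; first by constructor.
  by rewrite leq_add ?eval_cost_le.
by move=> b; rewrite /update; case: ifP.
Qed.

Lemma wp_seq p q Q s : wp p (wp q Q) s -> wp (Seq p q) Q s.
Proof.
move=> h /h[s' [t [pt tle s'B /(_ s'B)[s'' [t' [qt t'le s''B Qs]]]]]].
exists s'', (t + t')%N; split=> //; first exact: ExecSeq pt qt.
exact: leq_add.
Qed.

Lemma wp_if e p q Q s :
  (0 < eval s e -> wp p Q s) -> (eval s e <= 0 -> wp q Q s) -> wp (If e p q) Q s.
Proof.
move=> hp hq sB; have ce := eval_cost_le e sB; case: (ltP 0 (eval s e)) => e0.
  have [s' [t [pt tle s'B Qs]]] := hp e0 sB.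
  exists s', (eval_cost s e + t)%N; split=> //; first exact: ExecIfTrue.
  by rewrite leq_add // (leq_trans tle) ?leq_addr.
have [s' [t [pt tle s'B Qs]]] := hq e0 sB.
exists s', (eval_cost s e + t)%N; split=> //; first exact: ExecIfFalse.
by rewrite leq_add // (leq_trans tle) ?leq_addl.
Qed.

(** The invariant is indexed by the number of completed iterations; exactly [K] of them occur, so
    termination needs no separate measure. *)
Lemma wp_while (I : nat -> memory -> Prop) K e p Q s : (K <= N)%N ->
  I 0 s ->
  (forall i s', (i < K)%N -> I i s' -> 0 < eval s' e /\ wp p (I i.+1) s') ->
  (forall s', I K s' -> eval s' e <= 0 /\ Q s') ->
  wp (While e p) Q s.
Proof.
move=> KN I0 step final sB.
(* Induction on the number [r] of iterations left; the extra unit in [r.+1] pays for the final,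
   failing test. *)
suff: forall r i s', (i + r = K)%N -> I i s' -> memory_bounded B s' ->
    exists s'' t, [/\ exec (While e p) s' s'' t,
      (t <= r.+1 * (expr_time e B + cmd_time p N B))%N,
      memory_bounded B s'' & Q s''].
  case/(_ K 0 s erefl I0 sB) => s'' [t [h tle s''B Qs]].
  exists s'', t; split=> //; apply: leq_trans tle _.
  by rewrite /= leq_mul2r ltnS KN orbT.
elim=> [|r IH] i s' iK Ii s'B; have ce := eval_cost_le e s'B.
  rewrite addn0 in iK; subst i; have [e0 Qs] := final _ Ii.
  exists s', (eval_cost s' e); split=> //; first exact: ExecWhileFalse.
  by rewrite mul1n (leq_trans ce) ?leq_addr.
have iltK : (i < K)%N by lia.
have [e0 /(_ s'B)[s1 [t1 [h1 t1le s1B I1]]]] := step _ _ iltK Ii.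
have [|s2 [t2 [h2 t2le s2B Qs]]] := IH i.+1 s1 _ I1 s1B; first by lia.
exists s2, (eval_cost s' e + t1 + t2)%N; split=> //; first exact: ExecWhileTrue h2.
by rewrite mulSn leq_add // leq_add.
Qed.

End WeakestPrecondition.

(** Working cells have negative addresses, away from the input. *)
Definition var (v : nat) : expr := Fetch (Const (Negz v)).
Definition set_var (v : nat) (e : expr) : cmd := Store (Const (Negz v)) e.
Definition for_loop (v : nat) (e : expr) (p : cmd) : cmd :=
  Seq (set_var v (Const 0))
      (While (Minus e (var v)) (Seq p (set_var v (Plus (var v) (Const 1))))).

(** The invariant is insensitive to the counter cell, whose value is tracked separately. The bound
    [K < B] lets the final counter value [K] fit in a cell. *)
Lemma wp_for N B (I : nat -> memory -> Prop) K v e p (Q : memory -> Prop) s :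
  (K <= N)%N -> (K < B)%N ->
  (forall i s' z, I i s' -> I i (update s' (Negz v) z)) ->
  (forall i s', I i s' -> eval s' e = K%:Z) ->
  I 0 s ->
  (forall i s', (i < K)%N -> I i s' -> s' (Negz v) = i%:Z ->
     wp N B p (fun s'' => I i.+1 s'' /\ s'' (Negz v) = i%:Z) s') ->
  (forall s', I K s' -> Q s') ->
  wp N B (for_loop v e p) Q s.
Proof.
move=> KN KB Iv Ie I0 step final.
apply: wp_seq; apply: wp_store; first by rewrite /=; apply: bitlen_small; lia.
apply: (wp_while (I := fun i s' => I i s' /\ s' (Negz v) = i%:Z) KN).
- by split; [exact: Iv | rewrite /update /= eqxx].
- move=> i s' iK [Ii vi]; split; first by rewrite /= (Ie _ _ Ii) vi; lia.
  apply: wp_seq; apply: wp_mono (step _ _ iK Ii vi) => s'' [Ii' vi'].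
  apply: wp_store => /=; rewrite vi'; first by apply: bitlen_small; lia.
  by split; [exact: Iv | rewrite /update eqxx; lia].
- by move=> s' [Ii vi]; split; [rewrite /= (Ie _ _ Ii) vi; lia | exact: final].
Qed.

(** * The rounding program *)

(** This is [Negz (b + 4 * i)]. The bases 15 to 18 are distinct modulo 4 and exceed the scalar
    addresses, so four arrays of any length neither overlap nor hit a scalar. *)
Definition cell (b : nat) (i : nat) : int := Negz b - 4 * i%:Z.
Definition cell_expr (b : nat) (e : expr) : expr :=
  Minus (Const (Negz b)) (Times (Const 4) e).
Definition get (b : nat) (e : expr) : expr := Fetch (cell_expr b e).

Definition num_facilities : expr := Fetch (Const 0).
Definition num_clients : expr := Fetch (Const 1).

(** Here and in the other accessors of the input, [r] selects the numerator (0) or the denominator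
    (1), and 3 skips the header. *)
Definition cost_expr (r : nat) (i : expr) : expr :=
  Fetch (Plus (Const (3 + r)%N) (Times (Const 2) i)).
Definition entry_expr (i j : expr) : expr :=
  Times (Const 2) (Plus (Times i num_clients) j).
Definition dist_expr (r : nat) (i j : expr) : expr :=
  Fetch (Plus (Plus (Const (3 + r)%N) (Times (Const 2) num_facilities))
              (entry_expr i j)).
Definition assign_expr (r : nat) (i j : expr) : expr :=
  Fetch (Plus (Plus (Plus (Const (3 + r)%N) (Times (Const 4) num_facilities))
                    (Times (Const 2) (Times num_facilities num_clients)))
              (entry_expr i j)).

(* Positive exactly when facility i is near client j; the denominators being
   positive, the comparison is made without division. *)
Definition in_ball_expr (i j : expr) : expr :=
  Plus (Minus (Times (Const 4) (Times (get 15 j) (dist_expr 1 i j)))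
              (Times (Const 3) (Times (dist_expr 0 i j) (get 16 j))))
       (Const 1).

(* Fractions are added without reduction; each summand adds at most four times
   the bit length of an input number to the numerator and the denominator. *)
Definition radius_cmd : cmd :=
  let i := var 0 in let j := var 1 in
  let den := Times (dist_expr 1 i j) (assign_expr 1 i j) in
  Seq (Store (cell_expr 15 j) (Const 0))
  (Seq (Store (cell_expr 16 j) (Const 1))
  (for_loop 0 num_facilities
    (Seq (Store (cell_expr 15 j)
            (Plus (Times (get 15 j) den)
                  (Times (Times (dist_expr 0 i j) (assign_expr 0 i j)) (get 16 j))))
         (Store (cell_expr 16 j) (Times (get 16 j) den))))).

(** The outer conditional ensures that [test], which refers to the recorded candidate, is evaluated
    only once there is one. *)
Definition better_cmd (r v : nat) (test : expr) : cmd :=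
  let record := set_var r (Plus (var v) (Const 1)) in
  If (var r) (If test record Skip) record.

(** Multiplying a test by a 0/1 flag expresses conjunction: the product is positive exactly when
    both succeed. *)
Definition blocked_cmd : cmd :=
  Seq (set_var 3 (Const 0))
      (for_loop 0 num_facilities
         (If (Times (get 17 (var 0)) (in_ball_expr (var 0) (var 1)))
             (set_var 3 (Const 1)) Skip)).

Definition choose_client_cmd : cmd :=
  let j := var 1 in let best := Minus (var 4) (Const 1) in
  Seq (set_var 4 (Const 0))
      (for_loop 1 num_clients
         (Seq blocked_cmd
            (If (Minus (Const 1) (var 3))
                (better_cmd 4 1 (Minus (Times (get 15 best) (get 16 j))
                                       (Times (get 15 j) (get 16 best))))
                Skip))).

Definition open_facility_cmd : cmd :=
  let i := var 0 in let best := Minus (var 5) (Const 1) in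
  Seq (set_var 5 (Const 0))
  (Seq (for_loop 0 num_facilities
          (If (in_ball_expr i (Minus (var 4) (Const 1)))
              (Seq (Store (cell_expr 17 i) (Const 1))
                   (better_cmd 5 0
                      (Minus (Times (cost_expr 0 best) (cost_expr 1 i))
                             (Times (cost_expr 0 i) (cost_expr 1 best)))))
              Skip))
       (Store (cell_expr 18 best) (Const 1))).

(** A round that finds no unblocked client does nothing, which permits a fixed number of rounds. *)
Definition round_cmd : cmd :=
  Seq choose_client_cmd (If (var 4) open_facility_cmd Skip).

(** The number of facilities is saved first because the output overwrites cell 0, where it is
    stored. *)
Definition output_cmd : cmd :=
  Seq (set_var 6 num_facilities)
      (for_loop 0 (var 6) (Store (var 0) (get 18 (var 0)))).

(* The scalars live at Negz 0, ..., Negz 6: the loop counters i, j and t, the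
   flag "client j is blocked", one plus the best client and one plus the best
   facility found (0 if none), and n.  The arrays are interleaved: cells 15 and
   16 hold the numerator and denominator of the cost of client j, cells 17 and
   18 the flags "facility i is covered" and "facility i is open". *)
Definition rounding_cmd : cmd :=
  Seq (for_loop 1 num_clients radius_cmd)
      (Seq (for_loop 2 num_clients round_cmd) output_cmd).

(** * Searching for a minimum in one pass *)

Section ArgMin.
Variables (P : pred nat) (f : nat -> rat).

Definition argmin (k : nat) (r : int) : Prop :=
  (r = 0 /\ forall i, (i < k)%N -> ~~ P i) \/
  exists j, [/\ (j < k)%N, r = j.+1%:Z, P j &
                forall i, (i < k)%N -> P i -> f j <= f i].

Lemma argmin0 : argmin 0 0.
Proof. by left. Qed.

Lemma argmin_skip k r : ~~ P k -> argmin k r -> argmin k.+1 r.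
Proof.
move=> Pk [[r0 none]|[j [jk rj Pj min]]]; [left|right; exists j]; split=> //.
- by move=> i; rewrite ltnS leq_eqVlt => /predU1P[->|/none].
- exact: ltnW.
- by move=> i; rewrite ltnS leq_eqVlt => /predU1P[->|/min//]; rewrite (negPf Pk).
Qed.

Lemma argmin_keep k j : argmin k j.+1%:Z -> f j <= f k -> argmin k.+1 j.+1%:Z.
Proof.
move=> [[//]|[j' [jk [jj'] Pj min]]] jlek; subst j'; right; exists j; split=> //.
  exact: ltnW.
by move=> i; rewrite ltnS leq_eqVlt => /predU1P[->|/min].
Qed.

Lemma argmin_replace k r : P k -> argmin k r ->
  (forall j, r = j.+1%:Z -> f k <= f j) -> argmin k.+1 k.+1%:Z.
Proof.
move=> Pk am kler; right; exists k; split=> // i; rewrite ltnS leq_eqVlt.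
case/predU1P=> [->//|ik Pi]; case: am => [[_ none]|[j [jk rj Pj min]]].
  by have := none _ ik; rewrite Pi.
exact: le_trans (kler _ rj) (min _ ik Pi).
Qed.

Lemma wp_better N B r v test k s : (k.+1 < B)%N -> r != v ->
  s (Negz v) = k%:Z -> P k -> argmin k (s (Negz r)) ->
  (forall j, s (Negz r) = j.+1%:Z -> (j < k)%N ->
     (0 < eval s test) = (f k < f j)) ->
  wp N B (better_cmd r v test)
     (fun s' => argmin k.+1 (s' (Negz r)) /\
                forall a, a <> Negz r -> s' a = s a) s.
Proof.
move=> kB rv sv Pk am test_ok.
have rec : argmin k.+1 k.+1%:Z ->
    wp N B (set_var r (Plus (var v) (Const 1)))
      (fun s' => argmin k.+1 (s' (Negz r)) /\
                forall a, a <> Negz r -> s' a = s a) s.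
  move=> am'; apply: wp_store; rewrite /= sv; first by apply: bitlen_small; lia.
  split; first by rewrite /update eqxx -PoszD addn1.
  by move=> a /eqP/negPf; rewrite /update => ->.
case: (am) => [[r0 none]|[j [jk rj Pj min]]].
  apply: wp_if; rewrite /= r0 // => _; apply: rec.
  by apply: argmin_replace am _ => // j; rewrite r0.
apply: wp_if; rewrite /= rj // => _; apply: wp_if; rewrite ?leNgt (test_ok j) //.
- move=> kltj; apply: rec; apply: argmin_replace am _ => // j'.
  by rewrite rj => -[<-]; exact: ltW.
- rewrite -leNgt => jlek; apply: wp_skip; split=> //.
  by rewrite rj in am *; apply: argmin_keep.
Qed.

End ArgMin.

Lemma update_eq (s : memory) a v : update s a v a = v.
Proof. by rewrite /update eqxx. Qed.

Lemma update_neq (s : memory) a v b : b <> a -> update s a v b = s b.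
Proof. by move=> /eqP/negPf; rewrite /update => ->. Qed.

(** * Verification of the program, down to an abstract relation between rounds *)

Section Correctness.
Variables (w : seq int) (n m L N B : nat).
Hypotheses (w_n : w`_0 = n%:Z) (w_m : w`_1 = m%:Z).
Hypotheses (nL : (n <= L)%N) (mL : (m <= L)%N) (L_gt0 : (0 < L)%N).
Hypothesis wL : forall a, (bitlen w`_a <= L)%N.
Hypotheses (NL : (L <= N)%N) (BL : (4 * L * L + 4 * L + 4 <= B)%N).

Definition cost_at (r i : nat) : int := w`_(3 + r + 2 * i).
Definition dist_at (r i j : nat) : int := w`_(3 + r + 2 * n + 2 * (i * m + j)).
Definition assign_at (r i j : nat) : int :=
  w`_(3 + r + 4 * n + 2 * (n * m) + 2 * (i * m + j)).

Fixpoint radius_den (j k : nat) : int :=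
  if k is k'.+1 then radius_den j k' * (dist_at 1 k' j * assign_at 1 k' j) else 1.

Fixpoint radius_num (j k : nat) : int :=
  if k is k'.+1 then
    radius_num j k' * (dist_at 1 k' j * assign_at 1 k' j)
    + dist_at 0 k' j * assign_at 0 k' j * radius_den j k'
  else 0.

Definition in_ball (i j : nat) : bool :=
  3 * (dist_at 0 i j * radius_den j n) <= 4 * (radius_num j n * dist_at 1 i j).

(** Each step multiplies by products of two input numbers, below [2 ^ (2 * L)]. Both summands of the
    new numerator are thus below [X * Y], and their sum is below [X * Y * Y] since [Y >= 2]; hence
    [4 * L] bits per step. *)
Lemma radius_small j k :
  (`|radius_num j k| < 2 ^ (4 * L * k + 1))%N /\
  (`|radius_den j k| < 2 ^ (4 * L * k + 1))%N.
Proof.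
elim: k => [|k [IHn IHd]]; first by rewrite muln0.
have small a b : (absz (w`_a * w`_b)%R < 2 ^ (2 * L))%N.
  rewrite abszM mul2n -addnn expnD.
  have := wL a; rewrite bitlen_le => /andP[_ ?].
  by have := wL b; rewrite bitlen_le => /andP[_ ?]; exact: ltn_mul.
have h1 : (absz (dist_at 1 k j * assign_at 1 k j)%R < 2 ^ (2 * L))%N := small _ _.
have h2 : (absz (dist_at 0 k j * assign_at 0 k j)%R < 2 ^ (2 * L))%N := small _ _.
have e : (4 * L * k.+1 + 1 = (4 * L * k + 1) + 2 * L + 2 * L)%N by lia.
have h3 : (2 <= 2 ^ (2 * L))%N by rewrite -{1}[2%N]expn1 leq_exp2l //; lia.
rewrite [radius_num _ k.+1]/= [radius_den _ k.+1]/= e.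
rewrite (expnD 2 _ (2 * L)) (expnD 2 _ (2 * L)).
move: h1 h2 h3 IHn IHd; set X := (2 ^ (_ + 1))%N; set Y := (2 ^ _)%N.
set u := dist_at 1 k j * _; set v := dist_at 0 k j * _.
move=> h1 h2 h3 IHn IHd.
have lt_mul (a b : int) : (`|a| < X)%N -> (`|b| < Y)%N -> (absz (a * b)%R < X * Y)%N.
  by rewrite abszM; exact: ltn_mul.
have := lt_mul _ _ IHn h1; have := lt_mul _ _ IHd h1; have := lt_mul _ _ IHd h2.
rewrite (mulrC _ v); move: (_ * _) (_ * _) (_ * _) => p q r pX qX rX.
have : (X * Y * 2 <= X * Y * Y)%N by rewrite leq_mul2l h3 orbT.
by move: (X * Y)%N (X * Y * Y)%N pX qX rX => x y; lia.
Qed.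

Definition holds_input (s : memory) : Prop := forall a : nat, s a%:Z = w`_a.

Lemma eval_num_facilities s : holds_input s -> eval s num_facilities = n%:Z.
Proof. by move=> h; rewrite /= (h 0%N). Qed.

Lemma eval_num_clients s : holds_input s -> eval s num_clients = m%:Z.
Proof. by move=> h; rewrite /= (h 1%N). Qed.

Lemma eval_cell s b e i : eval s e = i%:Z -> eval s (cell_expr b e) = cell b i.
Proof. by move=> /= ->. Qed.

Lemma eval_get s b e i :
  eval s e = i%:Z -> eval s (get b e) = s (cell b i).
Proof. by move=> /= ->. Qed.

Lemma eval_cost_expr s r e i : holds_input s -> eval s e = i%:Z ->
  eval s (cost_expr r e) = cost_at r i.
Proof. by move=> h /= ->; rewrite /cost_at -h; congr (s _); lia. Qed.

Lemma eval_dist_expr s r ei ej i j : holds_input s ->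
  eval s ei = i%:Z -> eval s ej = j%:Z ->
  eval s (dist_expr r ei ej) = dist_at r i j.
Proof.
by move=> h /= -> ->; rewrite (h 0%N) (h 1%N) w_n w_m /dist_at -h; congr (s _); lia.
Qed.

Lemma eval_assign_expr s r ei ej i j : holds_input s ->
  eval s ei = i%:Z -> eval s ej = j%:Z ->
  eval s (assign_expr r ei ej) = assign_at r i j.
Proof.
by move=> h /= -> ->; rewrite (h 0%N) (h 1%N) w_n w_m /assign_at -h; congr (s _); lia.
Qed.

(** Over the integers, the summand 1 in the test turns strict positivity into the weak inequality of
    [in_ball]. *)
Lemma eval_in_ball s ei ej i j : holds_input s ->
  eval s ei = i%:Z -> eval s ej = j%:Z ->
  s (cell 15 j) = radius_num j n -> s (cell 16 j) = radius_den j n ->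
  (0 < eval s (in_ball_expr ei ej)) = in_ball i j.
Proof.
move=> h hi hj hn hd.
have := eval_dist_expr 0 h hi hj; have := eval_dist_expr 1 h hi hj.
have := eval_get 15 hj; have := eval_get 16 hj; rewrite hn hd.
rewrite /in_ball_expr.
move: (get _ _) (get _ _) (dist_expr _ _ _) (dist_expr _ _ _) => /= g1 g2 d1 d2.
move=> -> -> -> ->; rewrite /in_ball; lia.
Qed.

Lemma wp_radius s j (Q : memory -> Prop) : (j < m)%N ->
  holds_input s -> s (Negz 1) = j%:Z ->
  (forall s', s' (cell 15 j) = radius_num j n ->
     s' (cell 16 j) = radius_den j n ->
     (forall a, a <> Negz 0 -> a <> cell 15 j -> a <> cell 16 j -> s' a = s a) ->
     Q s') ->
  wp N B radius_cmd Q s.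
Proof.
move=> jm inp sj post.
apply: wp_seq; apply: wp_store; first by apply: bitlen_small; rewrite /=; lia.
rewrite [eval s _]/= sj.
apply: wp_seq; apply: wp_store; first by apply: bitlen_small; rewrite /=; lia.
rewrite [eval _ (cell_expr _ _)]/= [update s _ _ _]update_neq ?sj; last by lia.
pose I k (s' : memory) := [/\ s' (cell 15 j) = radius_num j k,
  s' (cell 16 j) = radius_den j k &
  forall a, a <> Negz 0 -> a <> cell 15 j -> a <> cell 16 j -> s' a = s a].
have Iinp k s' : I k s' -> holds_input s'.
  by move=> [_ _ fr] a; rewrite fr // /cell; lia.
apply: (wp_for (I := I) (K := n)).
- lia.
- lia.
- move=> k s' z [h1 h2 h3]; split; rewrite ?update_neq // /cell; try lia.
  by move=> a a0 a1 a2; rewrite update_neq // h3.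
- by move=> k s' /Iinp/eval_num_facilities.
- split; rewrite ?update_eq //.
    by rewrite update_neq ?update_eq // /cell; lia.
  by move=> a a0 a1 a2; rewrite !update_neq.
- move=> k s' kn Ik si; have inp' := Iinp _ _ Ik; case: Ik => h1 h2 h3.
  have sj' : s' (Negz 1) = j%:Z by rewrite h3 // /cell; lia.
  have [small1 small2] := radius_small j k.+1.
  have kB : (4 * L * k.+1 + 1 <= B)%N by nia.
  have fits z : (`|z| < 2 ^ (4 * L * k.+1 + 1))%N -> (bitlen z <= B)%N.
    by move=> zs; apply: leq_trans kB; rewrite bitlen_le zs addn1.
  have ed r := eval_dist_expr r inp' (si : eval s' (var 0) = _) (sj' : eval s' (var 1) = _).
  have ea r := eval_assign_expr r inp' (si : eval s' (var 0) = _) (sj' : eval s' (var 1) = _).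
  have e1 : eval s' (Plus (Times (get 15 (var 1))
       (Times (dist_expr 1 (var 0) (var 1)) (assign_expr 1 (var 0) (var 1))))
       (Times (Times (dist_expr 0 (var 0) (var 1)) (assign_expr 0 (var 0) (var 1)))
       (get 16 (var 1)))) = radius_num j k.+1.
    move: (ed 0%N) (ed 1%N) (ea 0%N) (ea 1%N).
    move: (dist_expr _ _ _) (dist_expr _ _ _) (assign_expr _ _ _) (assign_expr _ _ _).
    by move=> d0 d1 a0 a1 /= -> -> -> ->; rewrite sj' h1 h2.
  apply: wp_seq; apply: wp_store; first by rewrite e1; exact: fits.
  rewrite e1 (eval_cell 15 (sj' : eval s' (var 1) = _)).
  set s1 := update _ _ _.
  have inp1 : holds_input s1 by move=> a; rewrite /s1 update_neq // /cell; lia.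
  have si1 : eval s1 (var 0) = k%:Z by rewrite /= /s1 update_neq // /cell; lia.
  have sj1 : eval s1 (var 1) = j%:Z by rewrite /= /s1 update_neq // /cell; lia.
  have e2 : eval s1 (Times (get 16 (var 1))
       (Times (dist_expr 1 (var 0) (var 1)) (assign_expr 1 (var 0) (var 1))))
       = radius_den j k.+1.
    move: (eval_dist_expr 1 inp1 si1 sj1) (eval_assign_expr 1 inp1 si1 sj1).
    move: (dist_expr _ _ _) (assign_expr _ _ _) (eval_get 16 sj1).
    move: (get _ _) => g d1 a1 /= -> -> ->; rewrite /s1 update_neq ?h2 // /cell; lia.
  apply: wp_store; first by rewrite e2; exact: fits.
  rewrite e2 (eval_cell 16 sj1).
  rewrite /s1; split; last by rewrite !update_neq // /cell; lia.
  split; rewrite ?update_eq //.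
    by rewrite update_neq ?update_eq // /cell; lia.
  by move=> a a0 a1 a2; rewrite !update_neq // h3.
- by move=> s' [h1 h2 h3]; exact: post.
Qed.

Definition holds_radii (s : memory) : Prop := forall j, (j < m)%N ->
  s (cell 15 j) = radius_num j n /\ s (cell 16 j) = radius_den j n.

Lemma wp_radii s (Q : memory -> Prop) : holds_input s ->
  (forall s', holds_input s' -> holds_radii s' ->
     (forall i, s' (cell 17 i) = s (cell 17 i) /\ s' (cell 18 i) = s (cell 18 i)) ->
     Q s') ->
  wp N B (for_loop 1 num_clients radius_cmd) Q s.
Proof.
move=> inp post.
pose I k (s' : memory) := [/\ holds_input s',
  forall j, (j < k)%N ->
    s' (cell 15 j) = radius_num j n /\ s' (cell 16 j) = radius_den j n &
  forall i, s' (cell 17 i) = s (cell 17 i) /\ s' (cell 18 i) = s (cell 18 i)].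
apply: (wp_for (I := I) (K := m)).
- lia.
- lia.
- move=> k s' z [h1 h2 h3]; split.
  + by move=> a; rewrite update_neq.
  + by move=> j /h2; rewrite !update_neq // /cell; lia.
  + by move=> i; rewrite !update_neq // /cell; lia.
- by move=> k s' [/eval_num_clients].
- by split.
- move=> k s' km [h1 h2 h3] sk; apply: (wp_radius km h1 sk) => s2 e1 e2 fr.
  split; last by rewrite fr // /cell; lia.
  split.
  + by move=> a; rewrite fr // /cell; lia.
  + move=> j; rewrite ltnS leq_eqVlt => /predU1P[->//|jk].
    by have := h2 _ jk; rewrite !fr // /cell; lia.
  + by move=> i; rewrite !fr // /cell; lia.
- by move=> s' [h1 h2 h3]; exact: post.
Qed.

Definition holds_flags (s : memory) (cov opn : nat -> bool) : Prop :=
  forall i, (i < n)%N ->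
  s (cell 17 i) = (cov i : nat)%:Z /\ s (cell 18 i) = (opn i : nat)%:Z.

Definition blocked (cov : nat -> bool) (j k : nat) : bool :=
  has (fun i => cov i && in_ball i j) (iota 0 k).

Lemma blockedS cov j k :
  blocked cov j k.+1 = blocked cov j k || (cov k && in_ball k j).
Proof. by rewrite /blocked -addn1 iotaD has_cat /= orbF. Qed.

Lemma wp_blocked s j cov opn (Q : memory -> Prop) : (j < m)%N ->
  holds_input s -> holds_radii s -> holds_flags s cov opn -> s (Negz 1) = j%:Z ->
  (forall s', s' (Negz 3) = (blocked cov j n : nat)%:Z ->
     (forall a, a <> Negz 0 -> a <> Negz 3 -> s' a = s a) -> Q s') ->
  wp N B blocked_cmd Q s.
Proof.
move=> jm inp rad fl sj post.
apply: wp_seq; apply: wp_store; first by apply: bitlen_small; rewrite /=; lia.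
pose I k (s' : memory) := s' (Negz 3) = (blocked cov j k : nat)%:Z /\
  forall a, a <> Negz 0 -> a <> Negz 3 -> s' a = s a.
have Iinp k s' : I k s' -> holds_input s' by move=> [_ fr] a; rewrite fr.
apply: (wp_for (I := I) (K := n)).
- lia.
- lia.
- move=> k s' z [h1 h2]; split; first by rewrite update_neq.
  by move=> a a0 a1; rewrite update_neq // h2.
- by move=> k s' /Iinp/eval_num_facilities.
- by split; [rewrite update_eq | move=> a a0 a1; rewrite update_neq].
- move=> k s' kn Ik si; have inp' := Iinp _ _ Ik; case: Ik => h1 h2.
  have sj' : eval s' (var 1) = j%:Z by rewrite /= h2.
  have [e15 e16] := rad _ jm; have [e17 _] := fl _ kn.
  rewrite -!(h2 (cell _ _)) in e15 e16 e17; try by rewrite /cell; lia.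
  have := @eval_in_ball s' (var 0) (var 1) k j inp' si sj' e15 e16.
  have := eval_get 17 (si : eval s' (var 0) = k%:Z); rewrite e17.
  move: (get _ _) (in_ball_expr _ _) => g ib eg eib.
  apply: wp_if => /=; rewrite eg => cond.
  + rewrite /I; have -> : blocked cov j k.+1.
      by rewrite blockedS -eib; case: (cov k) cond => /=; lia.
    apply: wp_store; first by apply: bitlen_small; rewrite /=; lia.
    split; last by rewrite update_neq.
    by split; [rewrite update_eq | move=> a a0 a1; rewrite update_neq // h2].
  + apply: wp_skip; split=> //; split=> //.
    rewrite h1; have -> : blocked cov j k.+1 = blocked cov j k; last by [].
    by rewrite blockedS -eib; case: (cov k) cond => /=; lia.
- by move=> s' [h1 h2]; exact: post.
Qed.

Hypotheses (cost_den_gt0 : forall i, (i < n)%N -> 0 < cost_at 1 i)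
  (dist_den_gt0 : forall i j, (i < n)%N -> (j < m)%N -> 0 < dist_at 1 i j)
  (assign_den_gt0 : forall i j, (i < n)%N -> (j < m)%N -> 0 < assign_at 1 i j).

Definition cost_value (i : nat) : rat := (cost_at 0 i)%:~R / (cost_at 1 i)%:~R.
Definition dist_value (i j : nat) : rat := (dist_at 0 i j)%:~R / (dist_at 1 i j)%:~R.
Definition assign_value (i j : nat) : rat :=
  (assign_at 0 i j)%:~R / (assign_at 1 i j)%:~R.
Definition radius_value (j : nat) : rat :=
  (radius_num j n)%:~R / (radius_den j n)%:~R.

Lemma radius_den_gt0 j k : (j < m)%N -> (k <= n)%N -> 0 < radius_den j k.
Proof.
move=> jm; elim: k => //= k IH kn; apply: mulr_gt0; first by apply: IH; exact: ltnW.
by apply: mulr_gt0; [exact: dist_den_gt0 | exact: assign_den_gt0].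
Qed.

Lemma fraction_lt (a b c d : int) : 0 < b -> 0 < d ->
  (0 < a * d - c * b) = (c%:~R / d%:~R < a%:~R / b%:~R :> rat).
Proof.
move=> b0 d0; rewrite subr_gt0 ltr_pdivrMr ?ltr0z // mulrAC ltr_pdivlMr ?ltr0z //.
by rewrite -!intrM ltr_int.
Qed.

Lemma fraction_le (a b c d : int) : 0 < b -> 0 < d ->
  (c * b <= a * d) = (c%:~R / d%:~R <= a%:~R / b%:~R :> rat).
Proof. by move=> b0 d0; rewrite [RHS]leNgt -fraction_lt // -leNgt subr_le0. Qed.

Lemma radius_valueE j : (j < m)%N ->
  radius_value j = \sum_(0 <= i < n) dist_value i j * assign_value i j.
Proof.
move=> jm; rewrite /radius_value; move: (leqnn n).
(* The induction is on the number of facilities summed, with [n] kept as its upper bound: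
   denominators are known to be nonzero only below [n]. *)
elim: {1 3 4 5}n => [|k IH] kn; first by rewrite big_geq // mul0r.
rewrite big_nat_recr //= -IH ?(ltnW kn) // /dist_value /assign_value.
have n0 z : 0 < z -> z%:~R != 0 :> rat by rewrite intr_eq0 => /lt0r_neq0.
have := n0 _ (radius_den_gt0 jm (ltnW kn)).
have := n0 _ (dist_den_gt0 kn jm); have := n0 _ (assign_den_gt0 kn jm).
rewrite !(intrM, intrD) => h1 h2 h3; field; rewrite h1 h2 h3 //.
Qed.

Lemma in_ballE i j : (i < n)%N -> (j < m)%N ->
  in_ball i j = (3 * dist_value i j <= 4 * radius_value j).
Proof.
move=> iN jm; rewrite /in_ball !mulrA fraction_le; last 2 first.
- exact: radius_den_gt0.
- exact: dist_den_gt0.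
by rewrite /dist_value /radius_value !intrM.
Qed.

Lemma wp_choose_client s cov opn (Q : memory -> Prop) :
  holds_input s -> holds_radii s -> holds_flags s cov opn ->
  (forall s', argmin (fun j => ~~ blocked cov j n) radius_value m (s' (Negz 4)) ->
     (forall a, a <> Negz 0 -> a <> Negz 1 -> a <> Negz 3 -> a <> Negz 4 ->
        s' a = s a) -> Q s') ->
  wp N B choose_client_cmd Q s.
Proof.
move=> inp rad fl post.
apply: wp_seq; apply: wp_store; first by apply: bitlen_small; rewrite /=; lia.
pose I k (s' : memory) :=
  argmin (fun j => ~~ blocked cov j n) radius_value k (s' (Negz 4)) /\
  forall a, a <> Negz 0 -> a <> Negz 1 -> a <> Negz 3 -> a <> Negz 4 -> s' a = s a.
have Iinp k s' : I k s' -> holds_input s' by move=> [_ fr] a; rewrite fr.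
apply: (wp_for (I := I) (K := m)).
- lia.
- lia.
- move=> k s' z [h1 h2]; split; first by rewrite update_neq.
  by move=> a a0 a1 a3 a4; rewrite update_neq // h2.
- by move=> k s' /Iinp/eval_num_clients.
- split; first by rewrite update_eq; exact: argmin0.
  by move=> a a0 a1 a3 a4; rewrite update_neq.
- move=> k s' km Ik sk; have inp' := Iinp _ _ Ik; case: Ik => h1 h2.
  have rad' : holds_radii s' by move=> j /rad; rewrite !h2 // /cell; lia.
  have fl' : holds_flags s' cov opn by move=> i /fl; rewrite !h2 // /cell; lia.
  apply: wp_seq; apply: (wp_blocked km inp' rad' fl' sk) => s2 e3 fr.
  have rad2 : holds_radii s2 by move=> j /rad'; rewrite !fr // /cell; lia.
  have fr2 a : a <> Negz 0 -> a <> Negz 1 -> a <> Negz 3 -> a <> Negz 4 -> s2 a = s a.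
    by move=> *; rewrite fr // h2.
  rewrite -(fr (Negz 4)) // in h1; rewrite -(fr (Negz 1)) // in sk.
  apply: wp_if; rewrite /= e3 => cond.
  + have nb : ~~ blocked cov k n by case: blocked cond.
    have km1 : (k.+1 < B)%N by lia.
    apply: wp_mono _ (wp_better (P := fun j => ~~ blocked cov j n) N km1 _ sk nb h1 _)
      => // [s3 [am fr3]|j ej jk].
      split; last by rewrite fr3.
      by split=> // a a0 a1 a3 a4; rewrite fr3 // fr2.
    have best : eval s2 (Minus (var 4) (Const 1)) = j%:Z by rewrite /= ej; lia.
    have jm : (j < m)%N by lia.
    have := eval_get 15 best; have := eval_get 16 best.
    have := eval_get 15 (sk : eval s2 (var 1) = _).
    have := eval_get 16 (sk : eval s2 (var 1) = _).
    have [-> ->] := rad2 _ km; have [-> ->] := rad2 _ jm.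
    move: (get _ _) (get _ _) (get _ _) (get _ _) => g1 g2 g3 g4 /= -> -> -> ->.
    by rewrite fraction_lt // radius_den_gt0.
  + apply: wp_skip; split; last exact: sk; split=> //; apply: argmin_skip => //.
    by rewrite negbK; case: blocked cond.
- by move=> s' [h1 h2]; exact: post.
Qed.

(** Covering the ball and searching for its cheapest facility share one pass, since membership does
    not depend on the flags. A nonempty ball guarantees a recorded facility at the end. *)
Lemma wp_open_facility s j cov opn (Q : memory -> Prop) : (j < m)%N ->
  (exists2 i, (i < n)%N & in_ball i j) ->
  holds_input s -> holds_radii s -> holds_flags s cov opn ->
  s (Negz 4) = j.+1%:Z ->
  (forall s' i, (i < n)%N -> in_ball i j ->
     (forall i', (i' < n)%N -> in_ball i' j -> cost_value i <= cost_value i') ->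
     holds_input s' -> holds_radii s' -> s' (Negz 2) = s (Negz 2) ->
     holds_flags s' (fun i' => cov i' || in_ball i' j)
                    (fun i' => opn i' || (i' == i)) -> Q s') ->
  wp N B open_facility_cmd Q s.
Proof.
move=> jm [i0 i0n i0j] inp rad fl s4 post.
apply: wp_seq; apply: wp_store; first by apply: bitlen_small; rewrite /=; lia.
apply: wp_seq.
pose fr (s' : memory) := forall a, a <> Negz 0 -> a <> Negz 5 ->
  (forall i, a <> cell 17 i) -> s' a = s a.
pose I k (s' : memory) := [/\ fr s',
  holds_flags s' (fun i => cov i || (i < k)%N && in_ball i j) opn &
  argmin (in_ball^~ j) cost_value k (s' (Negz 5))].
have frinp s' : fr s' -> holds_input s' by move=> h a; rewrite h // /cell; lia.
have frrad s' : fr s' -> holds_radii s'.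
  by move=> h j' /rad; rewrite !h // /cell; lia.
apply: (wp_for (I := I) (K := n)).
- lia.
- lia.
- move=> k s' z [h1 h2 h3]; split; last by rewrite update_neq.
    by move=> a a0 a5 a17; rewrite update_neq // h1.
  by move=> i /h2; rewrite !update_neq // /cell; lia.
- by move=> k s' [/frinp/eval_num_facilities].
- split; last by rewrite update_eq; exact: argmin0.
    by move=> a a0 a5 a17; rewrite update_neq.
  by move=> i /fl; rewrite ltn0 andFb orbF !update_neq // /cell /=; lia.
- move=> k s' kn [h1 h2 h3] sk; have inp' := frinp _ h1; have rad' := frrad _ h1.
  have ej : eval s' (Minus (var 4) (Const 1)) = j%:Z.
    by rewrite /= h1 // ?s4 /cell; lia.
  have [e15 e16] := rad' _ jm.
  have ib := eval_in_ball inp' (sk : eval s' (var 0) = _) ej e15 e16.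
  apply: wp_if; first rewrite ib => kj.
  + apply: wp_seq; apply: wp_store; first by apply: bitlen_small; rewrite /=; lia.
    rewrite (eval_cell 17 (sk : eval s' (var 0) = _)).
    set s1 := update _ _ _.
    have inp1 : holds_input s1 by move=> a; rewrite /s1 update_neq // /cell; lia.
    have sk1 : s1 (Negz 0) = k%:Z by rewrite /s1 update_neq // /cell; lia.
    have s15 : s1 (Negz 5) = s' (Negz 5) by rewrite /s1 update_neq // /cell; lia.
    rewrite -s15 in h3; have kB : (k.+1 < B)%N by lia.
    apply: wp_mono _ (wp_better (P := in_ball^~ j) N kB _ sk1 kj h3 _)
      => // [s2 [am fr2]|i ei ik].
      split; last by rewrite fr2.
      split=> //.
        by move=> a a0 a5 a17; rewrite fr2 // /s1 update_neq // h1.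
      move=> i iN; have [c17 c18] := h2 _ iN.
      rewrite !fr2 /cell; try lia; rewrite /s1.
      have [->|ik] := eqVneq i k.
        rewrite update_eq ltnSn kj orbT update_neq /cell; last by lia.
        by split=> //; have [] := h2 _ kn.
      rewrite !update_neq /cell; try lia.
      by rewrite ltnS leq_eqVlt (negPf ik).
    have best : eval s1 (Minus (var 5) (Const 1)) = i%:Z by rewrite /= ei; lia.
    have iN : (i < n)%N by lia.
    have := eval_cost_expr 0 inp1 best; have := eval_cost_expr 1 inp1 best.
    have := eval_cost_expr 0 inp1 (sk1 : eval s1 (var 0) = _).
    have := eval_cost_expr 1 inp1 (sk1 : eval s1 (var 0) = _).
    move: (cost_expr _ _) (cost_expr _ _) (cost_expr _ _) (cost_expr _ _).
    by move=> g1 g2 g3 g4 /= -> -> -> ->; rewrite fraction_lt // cost_den_gt0.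
  + rewrite leNgt ib => kj; apply: wp_skip; split=> //; split=> //.
      move=> i iN; have := h2 _ iN; rewrite ltnS (leq_eqVlt i).
      by case: eqVneq => // ->; rewrite (negPf kj) !andbF.
    exact: argmin_skip.
- move=> s' [h1 h2 [[_ none]|[i [iN e5 ij min]]]].
    by have := none _ i0n; rewrite i0j.
  apply: wp_store; first by apply: bitlen_small; rewrite /=; lia.
  have best : eval s' (Minus (var 5) (Const 1)) = i%:Z by rewrite /= e5; lia.
  rewrite (eval_cell 18 best).
  apply: (post _ i) => //.
  + by move=> a; rewrite update_neq ?(frinp _ h1) // /cell; lia.
  + by move=> j' /(frrad _ h1); rewrite !update_neq // /cell; lia.
  + by rewrite update_neq ?h1 // /cell; lia.
  + move=> i' i'n; have [] := h2 _ i'n; rewrite i'n /=.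
    rewrite (update_neq _ _ (_ : cell 17 i' <> _)); last by rewrite /cell; lia.
    have [->|i'i] := eqVneq i' i; first by rewrite update_eq orbT.
    by rewrite orbF update_neq // /cell; lia.
Qed.

(** The effect of a round on the flags alone, so that the approximation analysis never looks at
    memories. The first case is an idle round. *)
Definition round_relation (cov opn cov' opn' : nat -> bool) : Prop :=
  [/\ forall j, (j < m)%N -> blocked cov j n, cov' = cov & opn' = opn] \/
  exists j i, [/\ [/\ (j < m)%N, ~~ blocked cov j n &
      forall j', (j' < m)%N -> ~~ blocked cov j' n -> radius_value j <= radius_value j'],
    [/\ (i < n)%N, in_ball i j &
      forall i', (i' < n)%N -> in_ball i' j -> cost_value i <= cost_value i'],
    cov' = (fun i' => cov i' || in_ball i' j) &
    opn' = (fun i' => opn i' || (i' == i))].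

Hypothesis ball_inhabited :
  forall j, (j < m)%N -> exists2 i, (i < n)%N & in_ball i j.

Lemma wp_round s cov opn (Q : memory -> Prop) :
  holds_input s -> holds_radii s -> holds_flags s cov opn ->
  (forall s' cov' opn', round_relation cov opn cov' opn' ->
     holds_input s' -> holds_radii s' -> s' (Negz 2) = s (Negz 2) ->
     holds_flags s' cov' opn' -> Q s') ->
  wp N B round_cmd Q s.
Proof.
move=> inp rad fl post.
apply: wp_seq; apply: (wp_choose_client inp rad fl) => s1 am fr.
have inp1 : holds_input s1 by move=> a; rewrite fr.
have rad1 : holds_radii s1 by move=> j /rad; rewrite !fr // /cell; lia.
have fl1 : holds_flags s1 cov opn by move=> i /fl; rewrite !fr // /cell; lia.
case: am => [[e4 none]|[j [jm e4 nb min]]].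
  apply: wp_if; rewrite /= e4 // => _; apply: wp_skip.
  apply: (post _ cov opn) => //; last exact: fr.
  by left; split=> // j /none; rewrite negbK.
apply: wp_if; rewrite /= e4 // => _.
apply: (wp_open_facility jm (ball_inhabited jm) inp1 rad1 fl1 e4).
move=> s' i iN ij imin inp' rad' e2 fl'; apply: post fl' => //.
  by right; exists j, i.
by rewrite e2 fr.
Qed.

Lemma wp_output s cov opn : holds_input s -> holds_flags s cov opn ->
  wp N B output_cmd
     (fun s' => forall i, (i < n)%N -> s' i%:Z = (opn i : nat)%:Z) s.
Proof.
move=> inp fl.
apply: wp_seq; apply: wp_store; rewrite eval_num_facilities //.
  by apply: bitlen_small; lia.
pose I k (s' : memory) := [/\ s' (Negz 6) = n%:Z,
  forall i, (i < n)%N -> s' (cell 18 i) = (opn i : nat)%:Z &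
  forall i, (i < k)%N -> s' i%:Z = (opn i : nat)%:Z].
apply: (wp_for (I := I) (K := n)).
- lia.
- lia.
- move=> k s' z [h1 h2 h3]; split; first by rewrite update_neq.
    by move=> i /h2; rewrite update_neq // /cell; lia.
  by move=> i /h3; rewrite update_neq.
- by move=> k s' [].
- split=> //.
  by move=> i /fl[_]; rewrite update_neq // /cell /=; lia.
- move=> k s' kn [h1 h2 h3] sk.
  have := eval_get 18 (sk : eval s' (var 0) = _); rewrite (h2 _ kn).
  move: (get _ _) => g eg; apply: wp_store; rewrite eg /= ?sk.
    by apply: bitlen_small; case: (opn k) => /=; lia.
  split; last by rewrite update_neq.
  split; first by rewrite update_neq.
    by move=> i /h2; rewrite update_neq // /cell; lia.
  move=> i; rewrite ltnS leq_eqVlt => /predU1P[->|ik]; first by rewrite update_eq.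
  by rewrite update_neq ?h3 //; lia.
- by move=> s' [].
Qed.

(** Any combinatorial invariant of [round_relation] transfers to the program; the one for the
    approximation factor is supplied later. *)
Lemma wp_rounding (Inv : nat -> (nat -> bool) -> (nat -> bool) -> Prop) :
  Inv 0 (fun=> false) (fun=> false) ->
  (forall t cov opn cov' opn', (t < m)%N -> Inv t cov opn ->
     round_relation cov opn cov' opn' -> Inv t.+1 cov' opn') ->
  wp N B rounding_cmd
    (fun s => exists cov opn, Inv m cov opn /\
       forall i, (i < n)%N -> s i%:Z = (opn i : nat)%:Z)
    (input_memory w).
Proof.
move=> Inv0 InvS.
have inp : holds_input (input_memory w) by [].
apply: wp_seq; apply: (wp_radii inp) => s1 inp1 rad1 c1.
apply: wp_seq.
pose I k (s' : memory) := exists cov opn,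
  [/\ Inv k cov opn, holds_input s', holds_radii s' & holds_flags s' cov opn].
apply: (wp_for (I := I) (K := m)).
- lia.
- lia.
- move=> k s' z [cov [opn [h1 h2 h3 h4]]]; exists cov, opn; split=> //.
  + by move=> j /h3; rewrite !update_neq // /cell; lia.
  + by move=> j /h4; rewrite !update_neq // /cell; lia.
- by move=> k s' [cov [opn [_ /eval_num_clients]]].
(* Array addresses are negative, where the initial memory is 0: at first no facility is covered or
   open. *)
- exists (fun=> false), (fun=> false); split=> // i _; have [-> ->] := c1 i.
  by rewrite /input_memory /cell; split; case E : (_ - _) => [b|//]; lia.
- move=> k s' km [cov [opn [h1 h2 h3 h4]]] sk.
  apply: (wp_round h2 h3 h4) => s2 cov' opn' rel inp2 rad2 e2 fl2.
  split; last by rewrite e2.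
  by exists cov', opn'; split=> //; exact: InvS rel.
- move=> s' [cov [opn [h1 h2 h3 h4]]]; apply: wp_mono (wp_output h2 h4) => s2 out.
  by exists cov, opn.
Qed.

End Correctness.

(** * Nearest assignments *)

Section NearestAssignment.
Variables (R : realType) (F C : finType) (c : F -> R) (d : F -> C -> R) (k : nat).
Hypotheses (d_ge0 : forall i j, 0 <= d i j) (k_gt0 : (0 < k)%N).
Implicit Types (T : {set F}) (x : F -> R) (z : {set C} -> F -> C -> R).

Definition opening T : F -> R := fun i => (i \in T)%:R.

Definition nearest T (j : C) : option F :=
  [pick i in T | [forall i' in T, d i j <= d i' j]].

Definition nearest_assignment T : F -> C -> R :=
  fun i j => (nearest T j == Some i)%:R.

(** Without clients, opening nothing is feasible and must be allowed as an optimum. *)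
Definition serves_clients T : bool := (T != set0) || (#|C| == 0).

Lemma nearestP T j : serves_clients T -> exists i,
  [/\ nearest T j = Some i, i \in T & forall i', i' \in T -> d i j <= d i' j].
Proof.
rewrite /serves_clients (cardD1 j) orbF => /set0Pn[i0 i0T].
rewrite /nearest; case: pickP => [i /andP[iT /forall_inP min]|none]; first by exists i.
case: (arg_minP (fun i => d i j) i0T) => i iT min.
by have /negP[] := none i; apply/andP; split=> //; apply/forall_inP.
Qed.

Lemma nearest_assignmentE T j i : nearest T j = Some i ->
  forall i', nearest_assignment T i' j = (i' == i)%:R.
Proof. by move=> e i'; rewrite /nearest_assignment e (eq_sym i'). Qed.

Lemma sum_nearest_assignment T j i : nearest T j = Some i ->
  \sum_i' d i' j * nearest_assignment T i' j = d i j.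
Proof.
move=> e; rewrite (bigD1 i) //= big1 => [|i' ii']; rewrite (nearest_assignmentE e).
  by rewrite eqxx mulr1 addr0.
by rewrite (negPf ii') mulr0.
Qed.

Lemma static_feasible_nearest T : serves_clients T ->
  static_feasible (opening T) (nearest_assignment T).
Proof.
move=> T_serves; split=> [j|i|i j]; first 1 last.
- by rewrite /opening ler0n.
- have [i' [e i'T _]] := nearestP j T_serves.
  rewrite (nearest_assignmentE e) /opening ler0n ler_nat.
  by case: eqVneq => // ->; rewrite i'T.
have [i [e _ _]] := nearestP j T_serves.
by rewrite (bigD1 i) //= (nearest_assignmentE e) eqxx lerDl sumr_ge0.
Qed.

Lemma urfl_feasible_nearest T : serves_clients T ->
  urfl_feasible k (opening T) (fun=> nearest_assignment T).
Proof.
move=> /static_feasible_nearest[h1 h2 h3]; split=> [S j _ _|i S j _ _|i|i S j _ _].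
- exact: h1.
- by case/andP: (h3 i j).
- by rewrite /opening; case: (i \in T); [right|left].
- by case/andP: (h3 i j).
Qed.

Lemma closest_assignment_nearest T : serves_clients T ->
  closest_assignment d k (opening T) (fun=> nearest_assignment T).
Proof.
move=> T_serves S j _ _; have [i [e iT min]] := nearestP j T_serves.
exists i; split; last exact: nearest_assignmentE.
split; first by rewrite /opening iT.
move=> i'; rewrite /opening; case: (boolP (i' \in T)) => [/min//|_ /eqP].
by rewrite eq_sym oner_eq0.
Qed.

(** Assignments vanish outside the open set and have total weight at least 1, so each client of a
    scenario pays at least its distance to a nearest open facility. *)
Lemma nearest_assignment_best x z : urfl_feasible k x z ->
  exists2 T, serves_clients T &
    urfl_cost c d k (opening T) (fun=> nearest_assignment T) <= urfl_cost c d k x z.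
Proof.
move=> [cover z_le x01 z_ge0]; pose T := [set i | x i == 1].
have T_serves : serves_clients T.
  have [/eqP C0|/card_gt0P[j _]] := posnP #|C|.
    by rewrite /serves_clients C0 orbT.
  (* The singleton scenario, available as [k >= 1], cannot be covered when nothing is open. *)
  have S1 : [set j] \in scenarios C k by rewrite inE cards1.
  rewrite /serves_clients; apply/orP; left; apply: contraTneq (cover _ j S1 (set11 j)).
  move=> T0; rewrite -ltNge (le_lt_trans _ ltr01) // sumr_le0 // => i _.
  apply: le_trans (z_le i _ j S1 (set11 j)) _; case: (x01 i) => [->//|xi].
  by move/setP/(_ i): T0; rewrite !inE xi eqxx.
exists T => //.
have xE i : opening T i = x i.
  by rewrite /opening inE; case: (x01 i) => ->; rewrite ?eqxx // eq_sym oner_eq0.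
rewrite /urfl_cost lerD //; first by apply: ler_sum => i _; rewrite xE.
apply: le_bigmax2 => S Sk; rewrite exchange_big [leRHS]exchange_big /=.
apply: ler_sum => j jS; have [i [e iT min]] := nearestP j T_serves.
rewrite (sum_nearest_assignment e).
apply: le_trans (_ : \sum_i' d i j * z S i' j <= _).
  by rewrite -mulr_sumr ler_peMr // cover.
apply: ler_sum => i' _; have [i'T|i'T] := boolP (i' \in T).
  by rewrite ler_wpM2r ?z_ge0 ?min.
have : z S i' j = 0; last by move=> ->; rewrite !mulr0.
apply/eqP; rewrite eq_le z_ge0 // andbT (le_trans (z_le _ _ _ Sk jS)) //.
by rewrite -xE /opening (negPf i'T).
Qed.

(** By [nearest_assignment_best] only finitely many candidates, one per facility set, compete, so
    the minimum is attained. *)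
Lemma urfl_optimal_value_exists : (0 < #|F|)%N ->
  exists2 T, serves_clients T &
    urfl_optimal_value c d k
      (urfl_cost c d k (opening T) (fun=> nearest_assignment T)).
Proof.
move=> /card_gt0P[i0 _].
have T0 : serves_clients [set: F].
  by rewrite /serves_clients; apply/orP; left; apply/set0Pn; exists i0.
pose cost T := urfl_cost c d k (opening T) (fun=> nearest_assignment T).
have [T T_serves best] := arg_minP cost T0.
exists T => //; split; first by exists (opening T), (fun=> nearest_assignment T);
  split=> //; exact: urfl_feasible_nearest.
move=> x z /nearest_assignment_best[T' T'_serves]; apply: le_trans; exact: best.
Qed.

Lemma nearest_assignment_cost T x (y : F -> C -> R) : serves_clients T ->
  \sum_(i in T) c i <= 4 * (\sum_i c i * x i) ->
  (forall j, exists2 i, i \in T & d i j <= 4 * \sum_i' d i' j * y i' j) ->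
  urfl_cost c d k (opening T) (fun=> nearest_assignment T)
    <= 4 * static_cost c d k x y.
Proof.
move=> T_serves open_cost near; rewrite /urfl_cost /static_cost mulrDr lerD //.
  apply: le_trans open_cost; rewrite [leRHS]big_mkcond; apply: ler_sum => i _.
  by rewrite /opening; case: ifP => _; rewrite ?mulr1 ?mulr0.
apply: bigmax_le => [|S Sk]; first by rewrite mulr_ge0 ?bigmax_ge_id.
apply: le_trans (_ : 4 * (\sum_i \sum_(j in S) d i j * y i j) <= _); last first.
  rewrite ler_pM2l //.
  exact: (le_bigmax_cond (0 : R)
    (fun S : {set C} => \sum_i \sum_(j in S) d i j * y i j : R) Sk).
rewrite exchange_big [X in 4 * X]exchange_big mulr_sumr /=.
apply: ler_sum => j _; have [i [e iT min]] := nearestP j T_serves.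
rewrite (sum_nearest_assignment e); have [i' i'T] := near j.
by apply: le_trans; exact: min.
Qed.

End NearestAssignment.

(** * Filtering and clustering *)

Section Filtering.
Variables (K : realFieldType) (F C : finType) (c : F -> K) (d : F -> C -> K).
Variables (x : F -> K) (y : F -> C -> K).
Hypotheses (c_ge0 : forall i, 0 <= c i) (d_ge0 : forall i j, 0 <= d i j).
(** The bipartite form of the triangle inequality, as only facility-client distances are given. *)
Hypothesis d_triangle : forall i i' j j', d i j' <= d i j + d i' j + d i' j'.
Hypotheses (y_cover : forall j, 1 <= \sum_i y i j) (y_ge0 : forall i j, 0 <= y i j).
Hypothesis y_le_x : forall i j, y i j <= x i.
Implicit Types cov opn : pred F.

Definition service_cost (j : C) : K := \sum_i d i j * y i j.
Definition near (i : F) (j : C) : bool := 3 * d i j <= 4 * service_cost j.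

(* Markov's inequality: a far facility has d i j > 4/3 * service_cost j, so the
   far facilities receive at most three quarters of the unit of demand. *)
Lemma near_mass j : 1 <= 4 * \sum_(i | near i j) y i j.
Proof.
have dy_ge0 i : true -> 0 <= d i j * y i j by rewrite mulr_ge0.
have D_ge0 : 0 <= service_cost j by apply: sumr_ge0.
have cover := y_cover j; rewrite (bigID (near^~ j)) /= in cover.
(* At service cost 0 one cannot divide by it; instead every far facility has positive distance,
   hence no share of the demand. *)
have [D0|D_neq0] := eqVneq (service_cost j) 0.
  suff far0 : \sum_(i | ~~ near i j) y i j = 0.
    by move: cover; rewrite far0; lra.
  rewrite big1 // => i; rewrite /near D0 mulr0 -ltNge => di_gt0.
  have /eqP := psumr_eq0P dy_ge0 D0 (erefl : xpredT i).
  by rewrite mulf_eq0 => /orP[/eqP di0|/eqP //]; move: di_gt0; rewrite di0 mulr0 ltxx.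
have far : 4 * service_cost j * (\sum_(i | ~~ near i j) y i j) <= 3 * service_cost j.
  rewrite [X in 3 * X](bigID (near^~ j)) /= mulrDr -[leLHS]add0r lerD //.
    by rewrite mulr_ge0 // sumr_ge0 // => i _; exact: dy_ge0.
  rewrite [leLHS]mulr_sumr [leRHS]mulr_sumr; apply: ler_sum => i; rewrite /near -ltNge => /ltW h.
  by rewrite mulrA ler_wpM2r.
have D_gt0 : 0 < service_cost j by rewrite lt_def D_neq0.
move: far cover; set near_sum := \sum_(i | near i j) _; set far_sum := \sum_(i | _) _.
by rewrite -mulrA mulrCA (mulrC 3) ler_pM2l //; lra.
Qed.

(** Four times the near mass is at least 1, so [c i] may be spread over the near facilities, where
    [c i <= c i'] and [y i' j <= x i']. *)
Lemma cheapest_cost i j : (forall i', near i' j -> c i <= c i') ->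
  c i <= 4 * \sum_(i' | near i' j) c i' * x i'.
Proof.
move=> cheapest; apply: le_trans (_ : c i * (4 * \sum_(i' | near i' j) y i' j) <= _).
  by rewrite ler_peMr // near_mass.
rewrite mulrCA ler_pM2l // mulr_sumr; apply: ler_sum => i' i'j.
by rewrite ler_pM // cheapest.
Qed.

(** Disjointness of the near set from [cov] means that its static cost has not been charged before.
    If [i] is already open, nothing is added on the left. *)
Lemma open_cheapest_cost cov opn i j :
  \sum_(i' | opn i') c i' <= 4 * (\sum_(i' | cov i') c i' * x i') ->
  (forall i', cov i' -> ~~ near i' j) ->
  (forall i', near i' j -> c i <= c i') ->
  \sum_(i' | opn i' || (i' == i)) c i'
    <= 4 * (\sum_(i' | cov i' || near i' j) c i' * x i').
Proof.
move=> cost disj cheapest.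
rewrite [in leRHS](bigID cov) /= [in leLHS](bigID opn) /= mulrDr lerD //.
  rewrite (eq_bigl opn) => [|i']; last by case: (opn i'); rewrite ?andbF.
  rewrite (eq_bigl cov (fun i' => c i' * x i')) // => i'.
  by case: (cov i'); rewrite ?andbF.
rewrite (eq_bigl (near^~ j) (fun i' => c i' * x i')) => [|i']; last first.
  by have := disj i'; case: (cov i') => //= [/(_ isT)/negPf->|]; rewrite ?andbT.
apply: le_trans (cheapest_cost cheapest).
have [opn_i|opn_i] := boolP (opn i).
  rewrite big_pred0 // => i'.
  by case: eqVneq => [->|_]; rewrite ?opn_i ?andbF // orbF andbN.
rewrite (big_pred1 i) // => i' /=.
by case: eqVneq => [->|_]; rewrite ?(negPf opn_i) // orbF andbN.
Qed.

Lemma near_detour i i' j j' : service_cost j <= service_cost j' ->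
  near i j -> near i' j -> near i' j' -> d i j' <= 4 * service_cost j'.
Proof. by rewrite /near; have := d_triangle i i' j j'; lra. Qed.

End Filtering.

(** * The input encoding *)

Definition code_seq (qs : seq rat) : seq int := flatten [seq code_rat q | q <- qs].

Lemma size_code_seq qs : size (code_seq qs) = (2 * size qs)%N.
Proof. by elim: qs => //= q qs; rewrite /code_seq /= => ->; lia. Qed.

Lemma nth_code_seq qs r k : (r < 2)%N -> (k < size qs)%N ->
  (code_seq qs)`_(r + 2 * k) = (code_rat qs`_k)`_r.
Proof.
move=> r2; elim: qs k => //= q qs IH [_|k]; first by case: r r2 {IH} => [|[]].
rewrite ltnS => /IH <-; have -> : (r + 2 * k.+1 = (r + 2 * k).+2)%N by lia.
by [].
Qed.

Lemma nth_allpairs (S T V : Type) (f : S -> T -> V) v0 s0 t0 s t a b :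
  (a < size s)%N -> (b < size t)%N ->
  nth v0 [seq f u v | u <- s, v <- t] (a * size t + b) = f (nth s0 s a) (nth t0 t b).
Proof.
elim: s a => //= u s IH [|a] sa tb; rewrite nth_cat size_map.
  by rewrite tb (nth_map t0).
by rewrite mulSn -addnA ltnNge leq_addr /= addKn IH.
Qed.

Section Encoding.
Variables (I : instance) (x : 'I_(nF I) -> rat) (y : 'I_(nF I) -> 'I_(nC I) -> rat).
Let n := nF I.
Let m := nC I.
Let w := encode x y.

Let entries (f : 'I_n -> 'I_m -> rat) := [seq f i j | i <- enum 'I_n, j <- enum 'I_m].
Let vect (f : 'I_n -> rat) := [seq f i | i <- enum 'I_n].

Let encodeE : w = [:: n%:Z; m%:Z; (bound I)%:Z] ++ code_seq (vect (@ocost I))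
  ++ code_seq (entries (@dst I)) ++ code_seq (vect x) ++ code_seq (entries y).
Proof.
have vectE f : map code_rat (vect f) = [seq code_rat (f i) | i <- enum 'I_n].
  by rewrite -map_comp.
by rewrite /w /encode /code_seq !vectE /entries !map_allpairs.
Qed.

Let size_vect f : size (vect f) = n.
Proof. by rewrite size_map size_enum_ord. Qed.

Let size_entries f : size (entries f) = (n * m)%N.
Proof. by rewrite size_allpairs !size_enum_ord. Qed.

Let nth_vect f (i : 'I_n) : (vect f)`_i = f i.
Proof. by rewrite (nth_map i) ?size_enum_ord // nth_ord_enum. Qed.

Let nth_entries f (i : 'I_n) (j : 'I_m) : (entries f)`_(i * m + j) = f i j.
Proof.
have := nth_allpairs f 0 i j (_ : i < size (enum 'I_n))%N (_ : j < size (enum 'I_m))%N.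
by rewrite !size_enum_ord !nth_ord_enum; apply.
Qed.

Let entry_lt (i : 'I_n) (j : 'I_m) : (i * m + j < n * m)%N.
Proof.
have : (i.+1 * m <= n * m)%N by rewrite leq_mul2r ltn_ord orbT.
by have := ltn_ord j; rewrite mulSn; lia.
Qed.

Let nth_catr (s1 s2 : seq int) a : (s1 ++ s2)`_(size s1 + a) = s2`_a.
Proof. by rewrite nth_cat ltnNge leq_addr addKn. Qed.

Lemma cost_atE r (i : 'I_n) : (r < 2)%N ->
  cost_at w r i = (code_rat (@ocost I i))`_r.
Proof.
move=> r2; rewrite /cost_at -addnA encodeE nth_catr nth_cat size_code_seq size_vect.
rewrite (_ : _ < _)%N; last by have := ltn_ord i; lia.
by rewrite nth_code_seq ?nth_vect // size_vect.
Qed.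

Lemma dist_atE r (i : 'I_n) (j : 'I_m) : (r < 2)%N ->
  dist_at w n m r i j = (code_rat (@dst I i j))`_r.
Proof.
move=> r2; rewrite /dist_at encodeE.
set a := (_ + _)%N; have -> : (a = 3 + (2 * n + (r + 2 * (i * m + j))))%N by rewrite /a; lia.
have sz : size (code_seq (vect (@ocost I))) = (2 * n)%N by rewrite size_code_seq size_vect.
rewrite nth_catr -{1}sz nth_catr nth_cat size_code_seq size_entries.
have ij := entry_lt i j; rewrite (_ : _ < _)%N; last by lia.
by rewrite nth_code_seq ?nth_entries // size_entries.
Qed.

Lemma assign_atE r (i : 'I_n) (j : 'I_m) : (r < 2)%N ->
  assign_at w n m r i j = (code_rat (y i j))`_r.
Proof.
move=> r2; rewrite /assign_at encodeE.
set a := (_ + _)%N.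
have -> : (a = 3 + (2 * n + (2 * (n * m) + (2 * n + (r + 2 * (i * m + j))))))%N.
  by rewrite /a; lia.
have sz f : size (code_seq (vect f)) = (2 * n)%N by rewrite size_code_seq size_vect.
have sz2 f : size (code_seq (entries f)) = (2 * (n * m))%N.
  by rewrite size_code_seq size_entries.
rewrite nth_catr -{1}(sz (@ocost I)) nth_catr -(sz2 (@dst I)) nth_catr -(sz x) nth_catr.
by rewrite nth_code_seq ?nth_entries // size_entries.
Qed.

Lemma nF_le_size : (n <= size w)%N.
Proof. by rewrite encodeE !size_cat !size_code_seq size_vect; lia. Qed.

(** The header gives [m] in binary; loops over the clients are polynomial because the distance
    matrix has at least one row, listing them all. *)
Lemma nC_le_size : (0 < n)%N -> (m <= size w)%N.
Proof.
move=> n0; rewrite encodeE !size_cat !size_code_seq !size_entries.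
by have := leq_pmull m n0; lia.
Qed.

Lemma fraction_value (f : nat -> int) q :
  (forall r, (r < 2)%N -> f r = (code_rat q)`_r) ->
  0 < f 1%N /\ (f 0%N)%:~R / (f 1%N)%:~R = q.
Proof. by move=> fE; rewrite !fE //= denq_gt0 divq_num_den. Qed.

End Encoding.

Lemma size_le_encoding_length (w : seq int) : (size w <= encoding_length w)%N.
Proof.
rewrite /encoding_length; elim: w => [|z w IH]; first by rewrite big_nil.
by rewrite big_cons /= -add1n leq_add.
Qed.

Lemma bitlen_le_encoding_length (w : seq int) a : (0 < size w)%N ->
  (bitlen w`_a <= encoding_length w)%N.
Proof.
move=> w0; have [aw|aw] := ltnP a (size w); last first.
  by rewrite nth_default // (leq_trans _ (size_le_encoding_length w)).
rewrite /encoding_length (big_rem w`_a) ?mem_nth //=; exact: leq_addr.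
Qed.

(** * Correctness of the rounding *)

(** The quadratic term holds the unreduced fractions: at most [L] additions of [4 * L] bits each.
    The rest leaves room for constants, counters and flags. *)
Definition cell_bound (L : nat) : nat := (4 * L * L + 4 * L + 4)%N.

Section Rounding.
Variables (I : instance) (x : 'I_(nF I) -> rat) (y : 'I_(nF I) -> 'I_(nC I) -> rat).
Let n := nF I.
Let m := nC I.
Let c := @ocost I.
Let d := @dst I.
Let w := encode x y.
Let L := encoding_length w.
Hypotheses (n_gt0 : (0 < n)%N) (c_ge0 : forall i, 0 <= c i).
Hypothesis d_ge0 : forall i j, 0 <= d i j.
Hypothesis d_triangle : forall i i' j j', d i j' <= d i j + d i' j + d i' j'.
Hypotheses (y_cover : forall j, 1 <= \sum_i y i j) (y_ge0 : forall i j, 0 <= y i j).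
Hypotheses (y_le_x : forall i j, y i j <= x i) (x_ge0 : forall i, 0 <= x i).

Let cost_code (i : 'I_n) := fraction_value (fun r r2 => cost_atE x y i r2).
Let dist_code (i : 'I_n) (j : 'I_m) := fraction_value (fun r r2 => dist_atE x y i j r2).
Let assign_code (i : 'I_n) (j : 'I_m) := fraction_value (fun r r2 => assign_atE x y i j r2).

Let dist_den_gt0 i j : (i < n)%N -> (j < m)%N -> 0 < dist_at w n m 1 i j.
Proof. by move=> iN jm; case: (dist_code (Ordinal iN) (Ordinal jm)). Qed.

Let assign_den_gt0 i j : (i < n)%N -> (j < m)%N -> 0 < assign_at w n m 1 i j.
Proof. by move=> iN jm; case: (assign_code (Ordinal iN) (Ordinal jm)). Qed.

Let radius_service (j : 'I_m) : radius_value w n m j = service_cost d y j.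
Proof.
rewrite radius_valueE // big_mkord; apply: eq_bigr => i _.
by congr (_ * _); [case: (dist_code i j) | case: (assign_code i j)].
Qed.

Let in_ball_near (i : 'I_n) (j : 'I_m) : in_ball w n m i j = near d y i j.
Proof.
rewrite in_ballE // radius_service /near; congr (3 * _ <= _).
by case: (dist_code i j).
Qed.

Let blocked_near cov (j : 'I_m) :
  blocked w n m cov j n = [exists i : 'I_n, cov i && near d y i j].
Proof.
apply/hasP/existsP => [[i]|[i]].
  rewrite mem_iota => /andP[_ iN] /andP[covi]; have -> := in_ball_near (Ordinal iN) j.
  by exists (Ordinal iN); rewrite covi.
move=> /andP[covi nij]; exists (val i); first by rewrite mem_iota /= ltn_ord.
by rewrite covi in_ball_near.
Qed.

(** The last clause measures progress: at [t = m] it forces every client to be blocked, and the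
    second clause then serves each of them. *)
Definition rounding_invariant (t : nat) (cov opn : nat -> bool) : Prop :=
  [/\ \sum_(i < n | opn i) c i <= 4 * (\sum_(i < n | cov i) c i * x i),
      forall (i' : 'I_n) (j : 'I_m), cov i' -> near d y i' j ->
        exists2 i : 'I_n, opn i & d i j <= 4 * service_cost d y j
    & (#|[pred j : 'I_m | ~~ blocked w n m cov j n]| <= m - t)%N].

Let rounding_step t cov opn cov' opn' : (t < m)%N ->
  rounding_invariant t cov opn -> round_relation w n m cov opn cov' opn' ->
  rounding_invariant t.+1 cov' opn'.
Proof.
move=> tm [inv_cost inv_near inv_card].
case=> [[all_blocked -> ->]|[j0 [i0 [[jm nb jmin] [iN ij imin] -> ->]]]].
  by split=> //; rewrite eq_card0 // => j; rewrite inE all_blocked.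
pose j := Ordinal jm; pose i := Ordinal iN.
have nij : near d y i j by rewrite -in_ball_near.
have disj (i' : 'I_n) : cov i' -> ~~ near d y i' j.
  move=> covi'; move: nb; rewrite (blocked_near cov j) => /existsPn/(_ i').
  by rewrite covi'.
split.
- have cheapest i' : near d y i' j -> c i <= c i'.
    rewrite -in_ball_near => /(imin _ (ltn_ord i')).
    have [_ e] := cost_code i; have [_ e'] := cost_code i'.
    by rewrite /cost_value e e'.
  have := open_cheapest_cost c_ge0 d_ge0 y_cover y_ge0 y_le_x inv_cost disj cheapest.
  by under [X in _ <= 4 * X]eq_bigl => i' do rewrite -(in_ball_near i' j).
- move=> i' j' cov_i' ni'j'.
  (* A client blocked earlier keeps its old facility. Otherwise the choice of [j] bounds its service
     cost by that of [j'], and [i'] must be newly covered, so the detour through [j] applies. *)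
  have [|nb'] := boolP (blocked w n m cov j' n).
    rewrite blocked_near => /existsP[i2 /andP[cov_i2 ni2j']].
    have [i3 open_i3 ?] := inv_near _ _ cov_i2 ni2j'.
    by exists i3; rewrite ?open_i3.
  exists i; first by rewrite eqxx orbT.
  case/orP: cov_i' => [cov_i'|]; last first.
    rewrite (in_ball_near i' j) => ni'j; apply: near_detour nij ni'j ni'j' => //.
    by rewrite -!radius_service; exact: jmin.
  by case/negP: nb'; rewrite blocked_near; apply/existsP; exists i'; rewrite cov_i'.
(* Blocked clients stay blocked, and [j] itself becomes blocked through [i], so the count drops
   strictly. *)
- rewrite -ltnS -subSn // subSS; apply: leq_trans inv_card.
  apply/proper_card/properP; split.
    apply/subsetP => j'; rewrite !inE !blocked_near; apply: contra.
    by case/existsP => i' /andP[covi' n']; apply/existsP; exists i'; rewrite covi'.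
  exists j; rewrite !inE // negbK blocked_near; apply/existsP; exists i.
  by rewrite ij orbT.
Qed.

Lemma wp_rounding_cmd :
  wp L (cell_bound L) rounding_cmd
    (fun s => exists T : {set 'I_n},
       [/\ forall i : 'I_n, s (val i)%:Z = ((i \in T) : nat)%:Z,
           \sum_(i in T) c i <= 4 * (\sum_i c i * x i)
         & forall j, exists2 i, i \in T & d i j <= 4 * \sum_i' d i' j * y i' j])
    (input_memory w).
Proof.
have wn : (n <= size w)%N by exact: nF_le_size.
have wm : (m <= size w)%N by exact: nC_le_size.
have wL := size_le_encoding_length w.
have ball_inhabited j : (j < m)%N -> exists2 i, (i < n)%N & in_ball w n m i j.
  move=> jm; have /existsP[i ni] : [exists i, near d y i (Ordinal jm)].
    (* An empty near set would have mass 0. *)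
    apply: contraTT (near_mass d_ge0 y_cover y_ge0 (Ordinal jm)) => /existsPn none.
    by rewrite big_pred0 ?mulr0 ?ler10 // => i; apply/negbTE.
  by exists i => //; rewrite (in_ball_near i (Ordinal jm)).
have inv0 : rounding_invariant 0 xpred0 xpred0.
  split=> //; first by rewrite !big_pred0 ?mulr0.
  by rewrite subn0 (leq_trans (max_card _)) ?card_ord.
have bits a : (bitlen w`_a <= L)%N by apply: bitlen_le_encoding_length; lia.
have cost_den i : (i < n)%N -> 0 < cost_at w 1 i.
  by move=> iN; case: (cost_code (Ordinal iN)).
have := @wp_rounding w n m L L (cell_bound L) erefl erefl (leq_trans wn wL)
  (leq_trans wm wL) (leq_trans (leq_trans n_gt0 wn) wL) bits (leqnn L) (leqnn _)
  cost_den dist_den_gt0 assign_den_gt0 ball_inhabited _ inv0 rounding_step.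
apply: wp_mono => s [cov [opn [[cost near_open card0] out]]].
exists [set i : 'I_n | opn i]; split.
- by move=> i; rewrite in_set (out _ (ltn_ord i)).
- rewrite (eq_bigl (fun i : 'I_n => opn i)) => [|i]; last by rewrite inE.
  apply: le_trans cost _; rewrite ler_pM2l // [leLHS]big_mkcond.
  by apply: ler_sum => i _; case: ifP => // _; exact: mulr_ge0.
- move=> j; have : blocked w n m cov j n.
    rewrite subnn leqn0 in card0.
    by move/eqP/card0_eq: card0 => /(_ j); rewrite inE => /negbFE.
  rewrite blocked_near => /existsP[i' /andP[cov_i' ni'j]].
  by have [i opn_i ?] := near_open _ _ cov_i' ni'j; exists i; rewrite ?inE.
Qed.

End Rounding.

(** * Assembling running time and approximation guarantee *)

Theorem theorem3 :
  exists (A : cmd) (p : {poly nat}),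
  forall (R : realType) (I : instance)
         (x : 'I_(nF I) -> rat) (y : 'I_(nF I) -> 'I_(nC I) -> rat),
  valid_instance R I ->
  static_optimal (@rcost R I) (@rdst R I) (bound I)
    (fun i => ratr (x i)) (fun i j => ratr (y i j)) ->
  exists (s : memory) (t : nat),
    [/\ exec A (input_memory (encode x y)) s t,
        (t <= p.[encoding_length (encode x y)])%N
      & exists z : {set 'I_(nC I)} -> 'I_(nF I) -> 'I_(nC I) -> R,
        [/\ closest_assignment (@rdst R I) (bound I)
              (@output_vector R (nF I) s) z,
            urfl_feasible (bound I) (@output_vector R (nF I) s) z
          & exists v : R,
              urfl_optimal_value (@rcost R I) (@rdst R I) (bound I) v /\
              urfl_cost (@rcost R I) (@rdst R I) (bound I)
                (@output_vector R (nF I) s) z <= 4 * v]].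
Proof.
have [p time_p] : poly_bounded (fun L => cmd_time rounding_cmd L (cell_bound L)).
  apply: (poly_bounded_cmd_time _ poly_bounded_id).
  have L4 := poly_boundedM (poly_bounded_cst 4) poly_bounded_id.
  exact (poly_boundedD (poly_boundedD (poly_boundedM L4 poly_bounded_id) L4)
                       (poly_bounded_cst 4)).
exists rounding_cmd, p => R I x y [n_gt0 k_gt0 c_ge0 [X [locF [locC dE]]]].
move=> [[y_cover x_ge0 y_le_x] optimal].
have {}dE i j : rdst R i j = mdist (locF i) (locC j) := dE i j.
have d_ge0 (i : 'I_(nF I)) (j : 'I_(nC I)) : 0 <= rdst R i j by rewrite dE mdist_ge0.
have y_bounds i j : 0 <= y i j <= x i.
  by have := y_le_x i j; rewrite ler_rat ler0q.
have := @wp_rounding_cmd I x y n_gt0 c_ge0.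
case.
- by move=> i j; have := d_ge0 i j; rewrite /rdst ler0q.
- move=> i i' j j'; rewrite -(ler_rat R) !rmorphD /=.
  rewrite -![ratr _]/(rdst R _ _) !dE.
  apply: le_trans (metric_triangle _ (locC j) _) _.
  by rewrite -addrA lerD2l (metric_sym (locF i')) metric_triangle.
- move=> j; rewrite -(ler_rat R) rmorph1 rmorph_sum; exact: y_cover.
- by move=> i j; case/andP: (y_bounds i j).
- by move=> i j; case/andP: (y_bounds i j).
- by move=> i; have := x_ge0 i; rewrite ler0q.
- move=> a; apply: leq_trans (_ : encoding_length (encode x y) <= _)%N.
    (* Negative cells hold 0, which is also the value read past the end of the code. *)
    case: a => a; last first.
      rewrite [input_memory _ _]/= -(nth_default 0 (leqnn (size (encode x y)))).
      exact: bitlen_le_encoding_length.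
    exact: bitlen_le_encoding_length.
  by rewrite /cell_bound; lia.
move=> s [t [run t_le _ [T [out open_cost close]]]].
exists s, t; split=> //; first by rewrite -time_p.
have T_serves : serves_clients 'I_(nC I) T.
  rewrite /serves_clients card_ord; have [_|m_gt0] := posnP (nC I).
    by rewrite orbT.
  have [i iT _] := close (Ordinal m_gt0).
  by apply/orP; left; apply/set0Pn; exists i.
have -> : @output_vector R (nF I) s = opening R T.
  by apply: boolp.funext => i; rewrite /output_vector out.
exists (fun=> nearest_assignment (@rdst R I) T); split.
- exact: closest_assignment_nearest.
- exact: urfl_feasible_nearest.
have F_gt0 : (0 < #|'I_(nF I)|)%N by rewrite card_ord.
have [T' T'_serves T'_opt] := urfl_optimal_value_exists (@rcost R I) d_ge0 k_gt0 F_gt0.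
exists (urfl_cost (@rcost R I) (@rdst R I) (bound I) (opening R T')
              (fun=> nearest_assignment (@rdst R I) T')); split=> //.
(* The optimal nearest assignment is independent of the scenario, hence a competitor in the static
   problem. *)
have static_le := optimal _ _ (static_feasible_nearest (@rdst R I) T'_serves).
apply: le_trans (_ : 4 * static_cost (@rcost R I) (@rdst R I) (bound I)
  (fun i => ratr (x i)) (fun i j => ratr (y i j)) <= _); last by rewrite ler_pM2l.
apply: nearest_assignment_cost => //.
  (* The analysis took place over the rationals, where the program computes; its bounds are now
     transported to [R]. *)
  have : ratr (\sum_(i in T) ocost i) <= ratr (4 * (\sum_i ocost i * x i)) :> R.
    by rewrite ler_rat.
  rewrite rmorphM !rmorph_sum /= rmorph_nat.
  by under [X in _ <= 4 * X -> _]eq_bigr => i _ do rewrite rmorphM.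
move=> j; have [i iT near_i] := close j; exists i => //.
have : ratr (dst i j) <= ratr (4 * (\sum_i' dst i' j * y i' j)) :> R.
  by rewrite ler_rat.
rewrite rmorphM rmorph_sum /= rmorph_nat.
by under [X in _ <= 4 * X -> _]eq_bigr => i' _ do rewrite rmorphM.
Qed.
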